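(* Let $P$ be a law on environments $\omega=(\omega_x)_{x\in\mathbb Z}$ such that: (i) under $P$ the $\omega_x$, $x\in\mathbb Z$, are i.i.d. and there is a constant $c>0$ with $P(\omega_x\in[c,1-c])=1$; (ii) $\omega_{\min}>1/2$ and $\alpha:=P(\omega_0=\omega_{\min})\in(0,1)$; (iii) there exists $\eta>0$ such that $P(\omega_0\in(\omega_{\min},\omega_{\min}+\eta))=0$. Then for any $\beta<2$, $$\lim_{n\to\infty}P_\omega\Big(\max_{k\le 2n}|X_k|\ge \frac{n}{(\ln n)^\beta}\,\Big|\,X_{2n}=0\Big)=0,\qquad P\text{-a.s.},$$ and for any $\gamma<1$, $$\lim_{n\to\infty}P_\omega\Big(\max_{k\le 2n}|X_k|\ge n^\gamma\,\Big|\,X_{2n}=0\Big)=1,\qquad P\text{-a.s.}$$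
   Context: An environment is $\omega=(\omega_x)_{x\in\mathbb Z}\in(0,1)^{\mathbb Z}$; $P$ is a probability law on environments, and $\omega_{\min}:=\inf\{x: P(\omega_0\le x)>0\}$. Given $\omega$, the random walk in random environment $(X_n)_{n\ge0}$ is, under the quenched law $P_\omega$, the time-homogeneous Markov chain on $\mathbb Z$ with $X_0=0$ that from site $x$ jumps to $x+1$ with probability $\omega_x$ and to $x-1$ with probability $1-\omega_x$. *)

(* Defs.v *)
From HB Require Import structures.
From mathcomp Require Import all_boot all_order all_algebra.
From mathcomp Require Import all_classical all_reals all_analysis.
From mathcomp Require Import lra zify.
Import Order.TTheory GRing.Theory Num.Theory.
Import numFieldNormedType.Exports.

Set SsrOldRewriteGoalsOrder.
Set Implicit Arguments.
Unset Strict Implicit.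
Unset Printing Implicit Defensive.

Local Open Scope classical_set_scope.
Local Open Scope ring_scope.

Definition unit_oo (R : realType) : Type := {x : R | (0 < x < 1)%R}.

Lemma half_in_unit_oo (R : realType) : (0 < (2^-1 : R) < 1)%R.
Proof. by rewrite invr_gt0 ltr0n /= invf_lt1 ?ltr0n// ltr1n. Qed.

HB.instance Definition _ (R : realType) := Choice.on (unit_oo R).
HB.instance Definition _ (R : realType) :=
  isPointed.Build (unit_oo R) (exist _ 2^-1 (half_in_unit_oo R)).

(* The space (0,1)^Z with its product sigma-algebra, generated by the
   coordinates. *)
Definition environment (R : realType) :=
  g_sigma_algebraType
    [set A : set (int -> unit_oo R) | exists (x : int) (B : set R),
       measurable B /\ A = [set w | B (\val (w x))]].

Definition site (R : realType) (x : int) (w : environment R) : R :=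
  \val (w x).

HB.instance Definition _ := isPointed.Build int 0.

(* The space Z^N with its product sigma-algebra, Z being discrete. *)
Definition trajectory :=
  g_sigma_algebraType
    [set A : set (nat -> int) | exists (n : nat) (y : int),
       A = [set X | X n = y]].

Definition mutually_independent d (T : measurableType d) (R : realType)
    (P : probability T R) (I : choiceType) (f : I -> T -> R) : Prop :=
  forall (s : seq I) (B : I -> set R), uniq s ->
    (forall i, measurable (B i)) ->
    fine (P [set t | forall i, i \in s -> B i (f i t)]) =
    \prod_(i <- s) fine (P (f i @^-1` B i)).

Definition identically_distributed d (T : measurableType d) (R : realType)
    (P : probability T R) (I : Type) (f : I -> T -> R) : Prop :=
  forall (i j : I) (B : set R), measurable B ->
    P (f i @^-1` B) = P (f j @^-1` B).

Definition omega_min (R : realType) (P : probability (environment R) R) : R :=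
  inf [set x : R | (0 < P [set w | (site 0 w <= x)%R])%E].

(* Equal to 0 when B is null. *)
Definition cond_prob d (T : measurableType d) (R : realType)
    (Q : probability T R) (A B : set T) : R :=
  fine (Q (A `&` B)) / fine (Q B).

Definition jump (R : realType) (w : environment R) (x y : int) : R :=
  if y == x + 1 then site x w
  else if y == x - 1 then 1 - site x w
  else 0.

(* Q is the law of the Markov chain on Z started at 0 with transition
   probabilities [jump w]; this determines Q uniquely, and such a Q exists for
   every w (see [quenched_law_exists]). *)
Definition quenched_law (R : realType) (w : environment R)
    (Q : probability trajectory R) : Prop :=
  Q [set X | X 0%N = 0] = 1%E /\
  forall (n : nat) (h : nat -> int) (y : int),
    let past := [set X : trajectory | forall k, (k <= n)%N -> X k = h k] in
    Q past != 0%E ->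
    cond_prob Q [set X | X n.+1 = y] past = jump w (h n) y.

Definition max_abs (X : trajectory) (m : nat) : nat :=
  \max_(k < m.+1) `|X k|%N.

(* The chain is realised on [0,1) with the uniform law: each finite history
   occupies an interval, which is cut in the proportions
   [site x w : 1 - site x w] to decide the next step from the current site x.
   A state is (left end, length, current site). *)
Section quenched_law_existence.
Context (R : realType) (w : environment R).

Let split (s : R * R * int) : R := s.1.1 + site s.2 w * s.1.2.

Let next (b : bool) (s : R * R * int) : R * R * int :=
  if b then (s.1.1, site s.2 w * s.1.2, s.2 + 1)
  else (split s, (1 - site s.2 w) * s.1.2, s.2 - 1).

Let st (b : seq bool) := foldr next (0, 1, 0) b.

Let Fixpoint bits (u : R) (n : nat) : seq bool :=
  if n is m.+1 then (u < split (st (bits u m))) :: bits u m else [::].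

Let coding (u : R) : trajectory := fun n => (st (bits u n)).2.

Let measurable_bits n s : measurable [set u : R | bits u n = s].
Proof.
elim: n s => [|n IH] [|b s] /=.
- by rewrite (_ : mkset _ = setT)//; apply/seteqP; split => u.
- by rewrite (_ : mkset _ = set0)//; apply/seteqP; split => u.
- by rewrite (_ : mkset _ = set0)//; apply/seteqP; split => u.
rewrite (_ : mkset _ = [set u | bits u n = s] `&`
  (if b then `]-oo, split (st s)[%classic else `[split (st s), +oo[%classic)).
  by apply: measurableI; [exact: IH|case: b].
apply/seteqP; split => u /=.
- by move=> [ub <-]; split=> //; case: b ub => /=; rewrite in_itv/= ?andbT// => /negbT; rewrite -leNgt.
- by move=> [->]; case: b; rewrite /= in_itv/= ?andbT ?leNgt; [move=> ->|move=> /negbTE ->].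
Qed.

Let measurable_coding_eq n y : measurable [set u : R | coding u n = y].
Proof.
rewrite (_ : mkset _ = \bigcup_s
  [set u : R | (st s).2 = y /\ bits u n = s]); last first.
  apply/seteqP; split => u /=; first by move=> h; exists (bits u n).
  by move=> [s /= _ [<- <-]].
apply: countable_bigcupT_measurable => // s.
have [sy|sy] := eqVneq (st s).2 y.
- rewrite (_ : mkset _ = [set u : R | bits u n = s]); first exact: measurable_bits.
  by apply/seteqP; split => u /=; tauto.
- rewrite (_ : mkset _ = set0)//; apply/seteqP; split => u //= -[]/eqP.
  by rewrite (negbTE sy).
Qed.

Let measurable_coding : measurable_fun [set: R] coding.
Proof.
apply: (@measurability _ _ _ _ setT coding
    [set A : set (nat -> int) | exists n y, A = [set X | X n = y]]) => //.
move=> _ [_ [n [y ->]] <-]; rewrite setTI; exact: measurable_coding_eq.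
Qed.

Let site_gt0 x : 0 < site x w.
Proof. by rewrite /site; case: (w x) => r /= /andP[]. Qed.

Let site_lt1 x : site x w < 1.
Proof. by rewrite /site; case: (w x) => r /= /andP[]. Qed.

Let st_len b : 0 < (st b).1.2.
Proof.
elim: b => [|[] b IH] //=; rewrite mulr_gt0// subr_gt0; exact: site_lt1.
Qed.

Let st_len1 b : 0 <= (st b).1.1 /\ (st b).1.1 + (st b).1.2 <= 1.
Proof.
elim: b => [|c b [IH1 IH2]] /=; first by rewrite add0r.
have := st_len b; have := site_gt0 (st b).2; have := site_lt1 (st b).2.
by case: c => /=; rewrite /split; nra.
Qed.

Let same_bits u v n : (forall k, (k <= n)%N -> coding u k = coding v k) ->
  bits u n = bits v n.
Proof.
elim: n => [//|n IH] H /=.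
have E : bits u n = bits v n by apply: IH => k kn; apply: H; exact: leqW.
rewrite E; congr cons; have := H n.+1 (leqnn _); rewrite /coding /= E.
by case: (u < _); case: (v < _) => //=; lia.
Qed.

Let cell (u : R) n := let s := st (bits u n) in `[s.1.1, s.1.1 + s.1.2[%classic.

Let past_cell u n : 0 <= u < 1 ->
  [set v : R | 0 <= v < 1 /\ forall k, (k <= n)%N -> coding v k = coding u k] =
  cell u n.
Proof.
move=> u01; elim: n => [|n IH].
  apply/seteqP; split => v; rewrite /cell/= in_itv/= add0r; first by case.
  by move=> v01; split => // k; rewrite leqn0 => /eqP ->.
have L := st_len (bits u n).
have W0 := site_gt0 (st (bits u n)).2; have W1 := site_lt1 (st (bits u n)).2.
have P0 := mulr_gt0 W0 L.
have P1 : 0 < (1 - site (st (bits u n)).2 w) * (st (bits u n)).1.2.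
  by rewrite mulr_gt0// subr_gt0.
apply/seteqP; split => v.
- move=> [v01 vu].
  have : cell u n v by rewrite -IH/=; split=> // k kn; apply: vu; exact: leqW.
  have := same_bits vu => /= -[Hb E].
  rewrite E in Hb; rewrite /cell/= !in_itv/= => /andP[a b].
  case: (ltP u _) Hb => _ /=; rewrite /split => h; apply/andP; split; try lra.
- move=> cv.
  have cv' : cell u n v.
    move: cv; rewrite /cell/= !in_itv/=; case: (ltP u _) => _ /=; rewrite /split; lra.
  have := cv'; rewrite -IH/= => -[v01 H]; split => // k.
  rewrite leq_eqVlt => /orP[/eqP ->|]; last by rewrite ltnS; exact: H.
  have E := same_bits H; rewrite /coding/= E.
  suff -> : (v < split (st (bits u n))) = (u < split (st (bits u n))) by [].
  move: cv; rewrite /cell/= in_itv/=; case: (ltP u _) => _ /=; rewrite /split; lra.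
Qed.


Let U : probability _ R := uniform_prob (@ltr01 R).

Let U_sub (A : set R) : measurable A -> A `<=` `[0, 1]%classic ->
  U A = lebesgue_measure A.
Proof.
move=> mA A01.
rewrite /U/= /uniform_prob integral_uniform_pdf (setIidl A01).
rewrite (eq_integral (cst 1%E)); last first.
  move=> x; rewrite inE => /A01; rewrite /= in_itv/= /uniform_pdf => ->.
  by rewrite subr0 invr1.
by rewrite integral_cst// mul1e.
Qed.

Let U01 (A : set R) : measurable A ->
  U A = U (A `&` `[0, 1[%classic).
Proof.
move=> mA; apply/esym/eqP; rewrite eq_le; apply/andP; split.
  by apply: le_measure; rewrite ?inE//; exact: measurableI.
rewrite -{1}(setUIDK A `[0, 1[%classic).
apply: le_trans (measureU2 _ _ _) _; [exact: measurableI|exact: measurableD|].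
rewrite -[leRHS]adde0 leeD2l//.
apply: (@le_trans _ _ (U (~` `[0, 1[%classic))).
  by apply: le_measure; rewrite ?inE//; [exact: measurableD|exact: measurableC].
rewrite probability_setC// U_sub//; last first.
  by move=> v /=; rewrite !in_itv/= => /andP[-> /ltW ->].
by rewrite lebesgue_measure_itv/= lte_fin ltr01 oppr0 adde0 subee.
Qed.

Let measurable_coding' :
  @measurable_fun _ _ (g_sigma_algebraType R.-ocitv.-measurable) trajectory
    setT coding.
Proof. exact: measurable_coding. Qed.

Let cod : {RV U >-> trajectory} := 
  @mfun_Sub _ _ (g_sigma_algebraType R.-ocitv.-measurable) trajectory coding
    (mem_set measurable_coding').

Let Q : probability trajectory R := distribution U cod.

Let past (h : nat -> int) n : set trajectory :=
  [set X | forall k, (k <= n)%N -> X k = h k].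

Let measurable_past h n : measurable (past h n).
Proof.
rewrite (_ : past h n = \bigcap_(k in [set k | (k <= n)%N]) [set X | X k = h k]).
  by apply: bigcap_measurableType => k _; apply: sub_sigma_algebra; exists k, (h k).
by apply/seteqP; split => X.
Qed.

Let Q_past u n : 0 <= u < 1 -> Q (past (coding u) n) = (st (bits u n)).1.2%:E.
Proof.
move=> u01; rewrite /Q/= /distribution/= /pushforward U01; last first.
  by rewrite -[X in measurable X]setTI; exact: measurable_coding.
rewrite (_ : _ `&` _ = cell u n).
  have [a b] := st_len1 (bits u n); have c := st_len (bits u n).
  rewrite U_sub.
  - rewrite /cell lebesgue_measure_itv/= lte_fin ltrDl c -EFinB.
    by rewrite addrAC subrr add0r.
  - exact: measurable_itv.
  - by move=> v; rewrite /cell/= !in_itv/=; lra.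
rewrite -past_cell//; apply/seteqP; split => v; rewrite /= in_itv/=; tauto.
Qed.

Let Q0 h n : ~ (exists u, 0 <= u < 1 /\ forall k, (k <= n)%N -> coding u k = h k) ->
  Q (past h n) = 0%E.
Proof.
move=> H; rewrite /Q/= /distribution/= /pushforward U01; last first.
  by rewrite -[X in measurable X]setTI; exact: measurable_coding.
rewrite (_ : _ `&` _ = set0) ?measure0//.
by apply/seteqP; split => v //=; rewrite in_itv/= => -[a b]; apply: H; exists v.
Qed.

Lemma quenched_law_exists : exists Q : probability trajectory R, quenched_law w Q.
Proof.
exists Q; split.
  rewrite (_ : mkset _ = past (coding 0) 0).
    by rewrite Q_past// lexx ltr01.
  by apply/seteqP; split => [X X0 k|X]; [rewrite leqn0 => /eqP ->|exact].
move=> n h y /=; rewrite -/(past h n) => /eqP Qp.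
have [[u [u01 uh]]|] := pselect (exists u, 0 <= u < 1 /\
  forall k, (k <= n)%N -> coding u k = h k); last by move/Q0.
have pE : past h n = past (coding u) n.
  by apply/seteqP; split => X H k kn; rewrite H// uh.
have L := st_len (bits u n); have [L0 L1] := st_len1 (bits u n).
have W0 := site_gt0 (h n); have W1 := site_lt1 (h n).
have hn : h n = (st (bits u n)).2 by rewrite -uh.
pose v := if y == h n + 1 then (st (bits u n)).1.1 else split (st (bits u n)).
have v01 : 0 <= v < 1.
  by rewrite /v; case: ifP => _; rewrite /split -?hn; nra.
have vu k : (k <= n)%N -> coding v k = coding u k.
  have : cell u n v.
    by rewrite /cell/= in_itv/= /v; case: ifP => _; rewrite /split -?hn; nra.
  by rewrite -past_cell//= => -[_]; apply.
have E := same_bits vu.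
have Hb : bits v n.+1 = (y == h n + 1) :: bits u n.
  rewrite /= E; congr cons; rewrite /v; case: ifP => _; rewrite /split -hn.
    by rewrite ltrDl mulr_gt0.
  by rewrite ltxx.
have Hc : coding v n.+1 = if y == h n + 1 then h n + 1 else h n - 1.
  by rewrite /coding Hb hn; case: (y == _).
have Hl : (st (bits v n.+1)).1.2 = (if y == h n + 1 then site (h n) w
   else 1 - site (h n) w) * (st (bits u n)).1.2.
  by rewrite Hb hn; case: (y == _).
rewrite /cond_prob pE Q_past//.
have [yE|yE] := boolP ((y == h n + 1) || (y == h n - 1)).
  have yc : coding v n.+1 = y.
    by rewrite Hc; case: eqP yE => //= _ /eqP.
  rewrite (_ : _ `&` _ = past (coding v) n.+1); last first.
    apply/seteqP; split => X /=.
      move=> [X1 X2] k; rewrite leq_eqVlt => /orP[/eqP ->|]; first by rewrite yc.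
      by rewrite ltnS => kn; rewrite X2// vu.
    move=> H; split; first by rewrite H// yc.
    by move=> k kn; rewrite H ?vu//; exact: leqW.
  rewrite Q_past// Hl /fine mulfK ?lt0r_neq0// /jump.
  by move: yE; case: (y == h n + 1) => //= ->.
move: yE; rewrite negb_or => /andP[y1 y2].
rewrite /jump (negbTE y1) (negbTE y2).
rewrite (_ : Q _ = 0%E) ?mul0r//.
pose h' k := if k == n.+1 then y else h k.
rewrite (_ : _ `&` _ = past h' n.+1).
  apply: Q0 => -[z [z01 zh]].
  have zu : forall k, (k <= n)%N -> coding z k = coding u k.
    move=> k kn; rewrite zh ?uh// /h'; first by rewrite ltn_eqF.
    exact: leqW.
  have := zh n.+1 (leqnn _); rewrite /h' eqxx /coding/= (same_bits zu).
  by case: (_ < _) => /=; rewrite -hn => yy; move: y1 y2; rewrite -yy eqxx.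
apply/seteqP; split => X /=.
  move=> [X1 X2] k; rewrite /h' leq_eqVlt => /orP[/eqP ->|].
    by rewrite eqxx X1.
  by rewrite ltnS => kn; rewrite ltn_eqF// X2// uh.
move=> H; split; first by rewrite H// /h' eqxx.
by move=> k kn; rewrite H ?leqW// /h' ltn_eqF// uh.
Qed.

End quenched_law_existence.

(* Main.v *)
(* Let p be the essential infimum of the site variables, q = 1 - p, r = sqrt(q/p)
   and rho = 2 sqrt(pq) = 2pr.  Tilting by r^x, the two outgoing weights of a site
   with value t become t r and (1 - t)/r, of sum rho - (1/r - r)(t - p): after
   division by rho the walk is simple at the sites with value p, and by the gap
   assumption it is killed with probability at least some delta > 0 at the other
   sites, the defects.
   A bridge of length 2n that stays among |x| <= n^g therefore weighs about
   (rho cos(pi/l))^(2n), where l ~ g ln n / |ln alpha| is the length of the longest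
   defect-free run: the upper bound comes from a supersolution made of cosines, the
   lower bound from reaching such a run and waiting there, at the cost
   exp(- O(n^g ln n)).  The weight thus increases with g < 1 by factors
   exp(c n / (ln n)^2), which gives the second limit.  A bridge that reaches
   distance m crosses a number of defects proportional to m and weighs at most
   rho^(2n) exp(- c m), negligible against exp(- C n / (ln n)^2) when
   m = n / (ln n)^beta with beta < 2, which gives the first limit. *)
Require Import Defs.
From mathcomp Require Import all_boot all_order all_algebra.
From mathcomp Require Import all_classical all_reals all_analysis.
From mathcomp Require Import measurable_realfun lra ring zify.
Import Order.TTheory GRing.Theory Num.Theory.
Import numFieldNormedType.Exports.

Local Open Scope classical_set_scope.
Local Open Scope ring_scope.

(** The tilt costs nothing on bridges: both endpoints are 0, where [r ^ x] is 1, so no factor of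
    order [r ^ m] survives, not even for excursions against the drift. Every estimate on weights is
    then a comparison, by induction on the number of steps, with a function that the one-step
    operator multiplies by at most, or at least, a constant. Randomness enters only through almost
    sure events that hold for all large integers k. For long runs in a box of size n the union bound
    is merely a small negative power of n, which need not be summable; in boxes of size e^k it is
    geometric in k. Afterwards k is taken next to g ln n, and all rounding is absorbed by strict
    inequalities between constants. In the second limit the two weights compared differ only in
    exponents of order n / (ln n)^2. The lower bound may therefore lose only a smaller order, which
    is why its run is sought within n^v, up to a logarithm, for a fixed v < 1, and why the constants
    must satisfy s g < v v. *)

(** * Elementary trigonometric inequalities *)

Lemma sin_le_id {R : realType} (x : R) : 0 <= x -> sin x <= x.
Proof.
rewrite le_eqVlt => /orP[/eqP <-|x0]; first by rewrite sin0.
have [z _] := @MVT R sin cos 0 x x0 (fun y _ => is_derive_sin y)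
  (continuous_subspaceT (@continuous_sin R)).
rewrite sin0 !subr0 => ->.
by rewrite ler_piMl ?(ltW x0)// cos_le1.
Qed.

Lemma cos_ge {R : realType} (x : R) : 0 <= x -> 1 - x ^+ 2 / 2 <= cos x.
Proof.
move=> x0; have := @cos_mulr2n R (x / 2).
rewrite (_ : x / 2 *+ 2 = x); last by rewrite -mulr_natr; lra.
rewrite cos2sin2 -mulr_natr => ->.
have h0 : 0 <= x / 2 by lra.
have [s0|s0] := leP 0 (sin (x / 2)).
  have := @sin_le_id R _ h0; nra.
have [xp|xp] := leP x (pi *+ 2).
  have : 0 <= sin (x / 2) by apply: sin_ge0_pi; lra.
  by rewrite leNgt s0.
have := sin_geN1 (x / 2); have := @pi_ge2 R; nra.
Qed.

Lemma sin_ge_half {R : realType} (x : R) : 0 <= x <= 1 -> x / 2 <= sin x.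
Proof.
case/andP; rewrite le_eqVlt => /orP[/eqP <-|x0] x1; first by rewrite sin0 mul0r.
have [z] := @MVT R sin cos 0 x x0 (fun y _ => is_derive_sin y)
  (continuous_subspaceT (@continuous_sin R)).
rewrite in_itv/= sin0 !subr0 => /andP[z0 zx] ->.
have := @cos_ge R z (ltW z0); nra.
Qed.

(** This quadratic gap turns two run lengths A1 ln n < A ln n into a gain of order 1 / (ln n)^2 per
    step. *)
Lemma cos_gap {R : realType} (t s : R) : 0 <= t -> t <= s -> s <= 1 ->
  (s ^+ 2 - t ^+ 2) / 8 <= cos t - cos s.
Proof.
move=> t0 ts s1.
have -> : cos t - cos s = 2 * (sin ((s + t) / 2) * sin ((s - t) / 2)).
  rewrite -[in cos t](_ : (s + t) / 2 - (s - t) / 2 = t); last by lra.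
  rewrite -[in cos s](_ : (s + t) / 2 + (s - t) / 2 = s); last by lra.
  by rewrite cosB cosD; ring.
have A : (s + t) / 2 / 2 <= sin ((s + t) / 2) by apply: sin_ge_half; lra.
have B : (s - t) / 2 / 2 <= sin ((s - t) / 2) by apply: sin_ge_half; lra.
have : (s + t) / 2 / 2 * ((s - t) / 2 / 2) <= sin ((s + t) / 2) * sin ((s - t) / 2).
  by apply: ler_pM => //; lra.
lra.
Qed.

Lemma cosB_add {R : realType} (a b : R) :
  cos (a + b) + cos (a - b) = 2 * cos b * cos a.
Proof. by rewrite cosD cosB; ring. Qed.

(** * Weights of nearest-neighbour bridges *)

(* Total weight of the N-step nearest-neighbour paths from x that satisfy [G];
   the predicate receives the sequence of visited sites without x itself. *)
Fixpoint pathsum {R : realType} (om : int -> R) (N : nat) (x : int)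
    (G : pred (seq int)) : R :=
  if N is N'.+1 then
    om x * pathsum om N' (x + 1) (fun s => G (x + 1 :: s)) +
    (1 - om x) * pathsum om N' (x - 1) (fun s => G (x - 1 :: s))
  else (G [::])%:R.

Definition bridge {R : realType} (om : int -> R) N x : R :=
  pathsum om N x (fun s => last x s == 0).

Definition bridge_hit {R : realType} (om : int -> R) (m : int) N x : R :=
  pathsum om N x (fun s => (m \in x :: s) && (last x s == 0)).

Definition bridge_in {R : realType} (om : int -> R) (m : nat) N x : R :=
  pathsum om N x
    (fun s => all (fun y : int => `|y| <= m)%N (x :: s) && (last x s == 0)).

Definition neighbour (x y : int) : bool := (y == x + 1) || (y == x - 1).

Section Pathsum.
Context {R : realType} (om : int -> R).
Hypothesis om01 : forall x, 0 <= om x <= 1.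

Let om0 x : 0 <= om x. Proof. by have /andP[] := om01 x. Qed.
Let om1 x : 0 <= 1 - om x. Proof. by have /andP[] := om01 x; lra. Qed.

Lemma pathsum_ext N x G G' : G =1 G' -> pathsum om N x G = pathsum om N x G'.
Proof.
elim: N x G G' => [|N IH] x G G' E /=; first by rewrite E.
by congr (_ * _ + _ * _); apply: IH => s; exact: E.
Qed.

Lemma pathsum_le_path N x (G G' : pred (seq int)) :
  (forall s, size s = N -> path neighbour x s -> G s -> G' s) ->
  pathsum om N x G <= pathsum om N x G'.
Proof.
elim: N x G G' => [|N IH] x G G' E /=.
  by case: (G _) (E [::] erefl erefl) => [->|_]; rewrite // ler0n.
by apply: lerD; apply: ler_wpM2l => //; apply: IH => s sN xs;
  apply: E; rewrite /= ?sN// xs /neighbour eqxx ?orbT.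
Qed.

Lemma pathsum_le N x (G G' : pred (seq int)) : (forall s, G s -> G' s) ->
  pathsum om N x G <= pathsum om N x G'.
Proof. by move=> GG; apply: pathsum_le_path => s _ _; exact: GG. Qed.

Lemma pathsum0 N x : pathsum om N x xpred0 = 0.
Proof. by elim: N x => [|N IH] x //=; rewrite !IH !mulr0 addr0. Qed.

Lemma pathsum_ge0 N x G : 0 <= pathsum om N x G.
Proof. by rewrite -(pathsum0 N x); exact: pathsum_le. Qed.

Lemma pathsumU_le N x (G1 G2 : pred (seq int)) :
  pathsum om N x (fun s => G1 s || G2 s) <=
  pathsum om N x G1 + pathsum om N x G2.
Proof.
elim: N x G1 G2 => [|N IH] x G1 G2 /=.
  by case: (G1 _); case: (G2 _) => /=; lra.
have A := ler_wpM2l (om0 x) (IH (x + 1) (fun s => G1 (x + 1 :: s))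
  (fun s => G2 (x + 1 :: s))).
have B := ler_wpM2l (om1 x) (IH (x - 1) (fun s => G1 (x - 1 :: s))
  (fun s => G2 (x - 1 :: s))).
by apply: le_trans (lerD A B) _; rewrite !mulrDr addrACA.
Qed.

Lemma bridgeS N x : bridge om N.+1 x =
  om x * bridge om N (x + 1) + (1 - om x) * bridge om N (x - 1).
Proof. by []. Qed.

Lemma bridge_ge0 N x : 0 <= bridge om N x.
Proof. exact: pathsum_ge0. Qed.

(** Comparison principle: [1 <= phi 0] makes [phi] dominate the terminal value, the indicator of 0,
    and each further step costs at most a factor [lam]. *)
Lemma bridge_le (phi : int -> R) (lam : R) : 0 <= lam ->
  (forall x, 0 <= phi x) -> 1 <= phi 0 ->
  (forall x, om x * phi (x + 1) + (1 - om x) * phi (x - 1) <= lam * phi x) ->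
  forall N x, bridge om N x <= lam ^+ N * phi x.
Proof.
move=> l0 p0 p1 H; elim=> [|N IH] x.
  by rewrite /bridge/= expr0 mul1r; case: eqP => [->|].
rewrite bridgeS exprSr -mulrA.
apply: le_trans (ler_wpM2l (exprn_ge0 N l0) (H x)).
rewrite mulrDr; apply: lerD; rewrite mulrCA; exact: ler_wpM2l.
Qed.

Lemma bridge_in_le (m : nat) (phi : int -> R) (lam : R) : 0 <= lam ->
  (forall x, 0 <= phi x) -> 1 <= phi 0 ->
  (forall x, (`|x| <= m)%N ->
    om x * phi (x + 1) + (1 - om x) * phi (x - 1) <= lam * phi x) ->
  forall N x, bridge_in om m N x <= lam ^+ N * phi x.
Proof.
move=> l0 p0 p1 H; elim=> [|N IH] x.
  rewrite /bridge_in/= expr0 mul1r andbT.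
  by case: leqP => _ //=; case: eqP => //= ->.
have [xm|xm] := leqP `|x| m; last first.
  rewrite /bridge_in (@pathsum_ext _ _ _ xpred0) ?pathsum0.
    by rewrite mulr_ge0// exprn_ge0.
  by move=> s /=; rewrite leqNgt xm.
have -> : bridge_in om m N.+1 x = om x * bridge_in om m N (x + 1) +
    (1 - om x) * bridge_in om m N (x - 1).
  by rewrite /bridge_in/=; congr (_ * _ + _ * _); apply: pathsum_ext => s /=;
    rewrite xm.
rewrite exprSr -mulrA.
apply: le_trans (ler_wpM2l (exprn_ge0 N l0) (H x xm)).
rewrite mulrDr; apply: lerD; rewrite mulrCA; exact: ler_wpM2l.
Qed.

(** Once at [m] the constraint is met, so the bound for unconstrained bridges serves as boundary
    value there. The inequality on [phi] is needed only before the first visit, in the region [D]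
    that the path cannot leave without passing through [m]. *)
Lemma bridge_hit_le (m : int) (D : pred int) (phi : int -> R) (lam : R) :
  0 <= lam -> (forall x, 0 <= phi x) ->
  (forall N, bridge om N m <= lam ^+ N * phi m) ->
  (forall x, D x -> x != m -> [/\ D (x + 1), D (x - 1) &
    om x * phi (x + 1) + (1 - om x) * phi (x - 1) <= lam * phi x]) ->
  forall N x, D x -> bridge_hit om m N x <= lam ^+ N * phi x.
Proof.
move=> l0 p0 pm H.
have hm N : bridge_hit om m N m <= lam ^+ N * phi m.
  by apply: le_trans (pm N); apply: pathsum_le => s /andP[].
elim=> [|N IH] x Dx.
  have [->|xm] := eqVneq x m; first exact: (hm 0%N).
  rewrite /bridge_hit/= inE eq_sym (negbTE xm)/=.
  by rewrite mulr_ge0// exprn_ge0.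
have [->|xm] := eqVneq x m; first exact: hm.
have [D1 D2 Hx] := H x Dx xm.
have -> : bridge_hit om m N.+1 x = om x * bridge_hit om m N (x + 1) +
    (1 - om x) * bridge_hit om m N (x - 1).
  rewrite /bridge_hit/=; congr (_ * _ + _ * _); apply: pathsum_ext => s /=;
    by rewrite in_cons [m == x]eq_sym (negbTE xm).
rewrite exprSr -mulrA.
apply: le_trans (ler_wpM2l (exprn_ge0 N l0) Hx).
rewrite mulrDr; apply: lerD; rewrite mulrCA; apply: ler_wpM2l => //; exact: IH.
Qed.

(** A bridge of the wrong parity weighs 0, so the comparison is restricted to sites of the right
    parity, which a step preserves relative to the remaining time. Where [phi] is nonpositive the
    bound is free, hence a subsolution is needed on [D] only. *)
Lemma bridge_ge_sub (D : pred int) (M : nat) (phi : int -> R) (lam : R) :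
  0 <= lam ->
  (forall x, ~~ D x -> phi x <= 0) ->
  (forall x, D x -> odd `|x| = odd M -> phi x <= bridge om M x) ->
  (forall x, D x ->
    lam * phi x <= om x * phi (x + 1) + (1 - om x) * phi (x - 1)) ->
  forall N x, odd `|x| = odd (N + M) -> lam ^+ N * phi x <= bridge om (N + M) x.
Proof.
move=> l0 nD pM H; elim=> [|N IH] x xo.
  rewrite expr0 mul1r; case/boolP: (D x) => Dx; first exact: pM.
  by apply: le_trans (nD _ Dx) _; exact: bridge_ge0.
case/boolP: (D x) => Dx; last first.
  apply: le_trans (bridge_ge0 _ _).
  by rewrite mulr_ge0_le0 ?exprn_ge0// nD.
have o1 : odd `|x + 1| = odd (N + M) by lia.
have o2 : odd `|x - 1| = odd (N + M) by lia.
rewrite addSn bridgeS exprSr -mulrA.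
apply: le_trans (ler_wpM2l (exprn_ge0 N l0) (H x Dx)) _.
rewrite mulrDr; apply: lerD; rewrite mulrCA; apply: ler_wpM2l => //; exact: IH.
Qed.

(** A single path is kept: left from [1 <= x], right otherwise. Once it has reached 0 it alternates
    between 0 and 1, and parity makes it end at 0. *)
Lemma bridge_ge_exp (c : R) : 0 <= c -> (forall x, c <= om x <= 1 - c) ->
  forall M x, (`|x| <= M)%N -> odd `|x| = odd M -> c ^+ M <= bridge om M x.
Proof.
move=> c0 H; elim=> [|M IH] x xM xo.
  by rewrite expr0 /bridge/= (_ : x = 0) ?eqxx//; lia.
have /andP[h1 h2] := H x.
rewrite bridgeS exprS; have [x0|x0] := leP 1 x.
  have /le_trans : c ^+ M <= bridge om M (x - 1) by apply: IH; lia.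
  move=> /(_ _ (lexx _)) h; rewrite -[leLHS]add0r; apply: lerD.
    by rewrite mulr_ge0// bridge_ge0.
  by apply: ler_pM; rewrite ?exprn_ge0//; lra.
have h : c ^+ M <= bridge om M (x + 1) by apply: IH; lia.
rewrite -[leLHS]addr0; apply: lerD; last by rewrite mulr_ge0// bridge_ge0.
by apply: ler_pM; rewrite ?exprn_ge0//; lra.
Qed.

Lemma bridge_ge_right (c : R) : 0 <= c -> (forall x, c <= om x <= 1 - c) ->
  forall a N x, c ^+ a * bridge om N (x + a%:Z) <= bridge om (a + N) x.
Proof.
move=> c0 H; elim=> [|a IH] N x; first by rewrite expr0 mul1r addr0.
have /andP[h1 h2] := H x.
rewrite addSn bridgeS exprS -mulrA -[leLHS]addr0; apply: lerD.
  apply: ler_pM => //; first by rewrite mulr_ge0 ?exprn_ge0 ?bridge_ge0.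
  have -> : x + a.+1%:Z = x + 1 + a%:Z by lia.
  exact: IH.
by rewrite mulr_ge0// bridge_ge0.
Qed.

End Pathsum.

(** * Upper bounds in a fixed environment *)

Definition run {R : realType} (om : int -> R) (p : R) (y : int) (l : nat) : Prop :=
  forall i, (i < l)%N -> om (y + i%:Z) = p.

(** Only the sites 0, ..., k - 1 are read; the left half-line is treated by reflecting [om]. *)
Definition defects {R : realType} (om : int -> R) (p : R) (k : nat) : nat :=
  (\sum_(i < k) (om i%:Z != p))%N.

Definition first_after (S : pred int) (x : int) (k : nat) : Prop :=
  S (x + k%:Z) /\ forall i : nat, (i < k)%N -> ~~ S (x + i%:Z).

Lemma first_after_exists (S : pred int) : (forall x, exists k : nat, S (x + k%:Z)) ->
  exists d : int -> nat, forall x, first_after S x (d x).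
Proof.
move=> H; suff /choice[d dP] : forall x, exists k, first_after S x k by exists d.
move=> x; case: (ex_minnP (H x)) => k Sk min; exists k; split=> // i ik.
by apply/negP => /min; rewrite leqNgt ik.
Qed.

Lemma first_after_uniq (S : pred int) x k k' :
  first_after S x k -> first_after S x k' -> k = k'.
Proof.
move=> [s1 m1] [s2 m2]; case: (ltngtP k k') => // h.
  by have := m2 _ h; rewrite s1.
by have := m1 _ h; rewrite s2.
Qed.

Lemma first_after0 (S : pred int) x : S x -> first_after S x 0.
Proof. by move=> Sx; split=> //; rewrite addr0. Qed.

Lemma first_afterS (S : pred int) x k : ~~ S x -> first_after S (x + 1) k ->
  first_after S x k.+1.
Proof.
move=> Sx [s m]; split; first by rewrite (_ : x + _ = x + 1 + k%:Z)//; lia.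
case=> [|i] ik; first by rewrite addr0.
by rewrite (_ : x + _ = x + 1 + i%:Z); [exact: m|lia].
Qed.

Lemma le_cos {R : realType} (x y : R) : 0 <= x -> x <= y -> y <= pi ->
  cos y <= cos x.
Proof.
by move=> x0 xy yp; rewrite leNgt ltr_cos ?in_itv/= -?leNgt//; apply/andP; lra.
Qed.

(** Controls the growth from an end of a run to its first interior site. The margin [C] keeps [y] at
    least [th * C / 2] below pi / 2, so [cos y] is at least [th * C / 4], while the increment
    [sin y * sin th] is at most [th], hence at most [4 / C] times [cos y]. *)
Lemma cos_shift_le {R : realType} (C y th l : R) : 0 < th <= 1 -> 0 < C ->
  th * (l + C) = pi -> th * C <= 2 -> 0 <= y -> y <= th * l / 2 ->
  cos (y - th) <= (1 + 4 / C) * cos y.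
Proof.
move=> /andP[th0 th1] C0 E tC y0 yl.
have cy : th * C / 4 <= cos y.
  have E' : th * l + th * C = pi by rewrite -mulrDr.
  have tC0 : 0 < th * C by rewrite mulr_gt0.
  have y1 : y <= pi / 2 - th * C / 2 by lra.
  have y2 : pi / 2 - th * C / 2 <= pi by have := @pi_ge0 R; lra.
  apply: le_trans (@le_cos R y _ y0 y1 y2).
  rewrite cosB cos_pihalf sin_pihalf mul0r mul1r add0r.
  have : th * C / 2 / 2 <= sin (th * C / 2) by apply: sin_ge_half; nra.
  lra.
have c0 : 0 <= cos y by apply: le_trans cy; rewrite divr_ge0// mulr_ge0// ltW.
have A : sin y * sin th <= th.
  have := sin_le1 y; have := @sin_ge0_pi R y; have := @sin_le_id R th (ltW th0).
  have pi1 := @pi_ge0 R.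
  have yp : 0 <= y <= pi by have := mulr_gt0 th0 C0; rewrite mulrDr in E; lra.
  have tp : 0 <= th <= pi by have := @pi_ge2 R; lra.
  have := @sin_ge0_pi R th tp; move=> a b c1 d; have := c1 yp; nra.
have B : cos y * cos th <= cos y by rewrite ler_piMr// cos_le1.
rewrite cosB mulrDl mul1r; apply: lerD => //; apply: le_trans A _.
rewrite mulrAC ler_pdivlMr//; lra.
Qed.

Section Deterministic.
Context {R : realType} (om : int -> R) (p r delta : R).
Hypotheses (p1 : 2^-1 < p < 1) (r0 : 0 < r) (pr2 : p * r ^+ 2 = 1 - p).
Hypothesis delta01 : 0 < delta < 1.
Hypothesis om01 : forall x, 0 < om x < 1.
Hypothesis om_defect : forall x, om x != p ->
  om x * r + (1 - om x) / r <= 2 * p * r * (1 - delta).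

Let rho := 2 * p * r.

Let om01' x : 0 <= om x <= 1.
Proof. by have /andP[/ltW -> /ltW ->] := om01 x. Qed.

Let rho0 : 0 < rho.
Proof. by rewrite /rho !mulr_gt0//; case/andP: p1; lra. Qed.

Lemma tilt_lt1 : r < 1.
Proof.
case/andP: p1 => ph p1'; rewrite ltNge; apply/negP => r1.
have : p * 1 <= p * r ^+ 2 by rewrite ler_pM2l ?exprn_ege1//; lra.
by rewrite pr2; lra.
Qed.

Let qr : (1 - p) / r = p * r.
Proof. by rewrite -pr2 expr2 mulrA mulfK// gt_eqF. Qed.

Lemma rho_le1 : 2 * p * r <= 1.
Proof.
have /andP[ph p1'] := p1.
have h : (2 * p * r) ^+ 2 <= 1.
  have -> : (2 * p * r) ^+ 2 = 4 * p * (p * r ^+ 2) by ring.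
  rewrite pr2; have := sqr_ge0 (2 * p - 1); rewrite expr2; lra.
by rewrite -(@ler_pXn2r _ 2%N)// ?expr1n// nnegrE; [exact: ltW|].
Qed.

Lemma tilt_weight_le x : om x * r + (1 - om x) / r <= rho * (1 - delta) ^+ (om x != p).
Proof.
have [->|ne] := eqVneq (om x) p; last by rewrite expr1; exact: om_defect.
by rewrite /= expr0 mulr1 qr /rho; lra.
Qed.

Lemma tilt_step x (u1 u2 : R) :
  om x * (r ^ (x + 1) * u1) + (1 - om x) * (r ^ (x - 1) * u2) =
  r ^ x * (om x * r * u1 + (1 - om x) / r * u2).
Proof.
have rU : r \is a GRing.unit by rewrite unitfE gt_eqF.
by rewrite !exprzDr// expr1z exprN1; ring.
Qed.

Lemma tilt_step_le x (u1 u2 B : R) : u1 <= B -> u2 <= B -> 0 <= B ->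
  om x * (r ^ (x + 1) * u1) + (1 - om x) * (r ^ (x - 1) * u2) <=
  rho * (r ^ x * ((1 - delta) ^+ (om x != p) * B)).
Proof.
move=> h1 h2 B0; rewrite tilt_step [leRHS]mulrCA; apply: ler_wpM2l.
  by rewrite exprz_ge0// ltW.
have /andP[w1 w2] := om01 x.
apply: (@le_trans _ _ ((om x * r + (1 - om x) / r) * B)).
  rewrite [leRHS]mulrDl; apply: lerD; apply: ler_wpM2l => //.
    by rewrite mulr_ge0 ?ltW.
  by rewrite divr_ge0 ?(ltW r0)// subr_ge0 ltW.
by rewrite mulrA; apply: ler_wpM2r => //; exact: tilt_weight_le.
Qed.

Lemma bridge_le_tilt N x : bridge om N x <= rho ^+ N * r ^ x.
Proof.
apply: (@bridge_le R om om01' (fun x => r ^ x)); first exact: ltW.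
- by move=> y; rewrite exprz_ge0// ltW.
- by rewrite expr0z.
move=> y; have := @tilt_step_le y 1 1 1 (lexx _) (lexx _) ler01.
rewrite !mulr1 => /le_trans; apply; apply: ler_wpM2l; first exact: ltW.
apply: ler_piMr; first by rewrite exprz_ge0// ltW.
by rewrite exprn_ile1//; case/andP: delta01; lra.
Qed.

Let damping_ge0 k : 0 <= (1 - delta) ^+ k.
Proof. by rewrite exprn_ge0//; case/andP: delta01; lra. Qed.

(* Supersolution: r^x (1 - delta)^(number of defects in [x, m)). *)
Lemma bridge_hit_right (m N : nat) :
  bridge_hit om m%:Z N 0 <= rho ^+ N * (1 - delta) ^+ defects om p m.
Proof.
pose D (x : int) := (\sum_(i < `|m%:Z - x|%N) (om (x + i%:Z) != p))%N.
have DS (x : int) : x < m%:Z -> D x = addn (om x != p) (D (x + 1)).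
  move=> xm; rewrite /D (_ : `|m%:Z - x|%N = (absz (m%:Z - (x + 1))%R).+1); last by lia.
  rewrite big_ord_recl addr0; congr (_ + _)%N; apply: eq_bigr => i _.
  by rewrite lift0 (_ : x + _ = x + 1 + i%:Z)//; lia.
have -> : defects om p m = D 0.
  by rewrite /D subr0 absz_nat; apply: eq_bigr => i _; rewrite add0r.
have Dm : D m%:Z = 0%N by rewrite /D subrr big_ord0.
have := @bridge_hit_le R om om01' m%:Z (fun x => x <= m%:Z)
  (fun x => r ^ x * (1 - delta) ^+ D x) rho (ltW rho0) _ _ _ N 0 _.
rewrite expr0z mul1r; apply => //.
- by move=> x; rewrite mulr_ge0// exprz_ge0// ltW.
- by move=> k; rewrite Dm expr0 mulr1; exact: bridge_le_tilt.
move=> x xm xm'; split; [lia|lia|].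
have xl : x < m%:Z by lia.
have Dx := DS x xl.
(* The left neighbour sees even more defects than [x], so both neighbours are bounded by the damping
   at [x + 1]; the killing at [x] supplies the missing factor. *)
have Dx1 : (D x <= D (x - 1)%R)%N.
  by rewrite (DS (x - 1)); [rewrite subrK leq_addl|lia].
rewrite [in leRHS]Dx exprD; apply: tilt_step_le => //.
apply: ler_wiXn2l; [by case/andP: delta01; lra|by case/andP: delta01; lra|].
by apply: leq_trans Dx1; rewrite Dx leq_addl.
Qed.

(** The value [r ^ (- m)] at the target is large, but the bound is read at the starting point 0,
    where the tilt is 1. The damping now counts the defects in (-m, x]. *)
Lemma bridge_hit_left (m N : nat) :
  bridge_hit om (- m%:Z) N 0 <=
  rho ^+ N * (1 - delta) ^+ defects (fun x => om (- x)) p m.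
Proof.
pose D (x : int) := (\sum_(i < `|(x + m%:Z)%R|%N) (om (x - i%:Z) != p))%N.
have DS (x : int) : - m%:Z < x -> D x = addn (om x != p) (D (x - 1)).
  move=> xm; rewrite /D (_ : `|(x + m%:Z)%R|%N = (absz (x - 1 + m%:Z)%R).+1); last by lia.
  rewrite big_ord_recl subr0; congr (_ + _)%N; apply: eq_bigr => i _.
  by rewrite lift0 (_ : x - _ = x - 1 - i%:Z)//; lia.
have -> : defects (fun x => om (- x)) p m = D 0.
  by rewrite /D add0r absz_nat; apply: eq_bigr => i _; rewrite add0r.
have Dm : D (- m%:Z) = 0%N by rewrite /D addNr big_ord0.
have := @bridge_hit_le R om om01' (- m%:Z) (fun x => - m%:Z <= x)
  (fun x => r ^ x * (1 - delta) ^+ D x) rho (ltW rho0) _ _ _ N 0 _.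
rewrite expr0z mul1r; apply => //; rewrite ?lerNl ?oppr0//.
- by move=> x; rewrite mulr_ge0// exprz_ge0// ltW.
- by move=> k; rewrite Dm expr0 mulr1; exact: bridge_le_tilt.
move=> x xm xm'; split; [lia|lia|].
have xl : - m%:Z < x by lia.
have Dx := DS x xl.
have Dx1 : (D x <= D (x + 1)%R)%N.
  by rewrite (DS (x + 1)); [rewrite addrK leq_addl|lia].
rewrite [in leRHS]Dx exprD; apply: tilt_step_le => //.
apply: ler_wiXn2l; [by case/andP: delta01; lra|by case/andP: delta01; lra|].
by apply: leq_trans Dx1; rewrite Dx leq_addl.
Qed.

(* The supersolution is r^x times a function that, on each run between two
   defects, is a cosine of frequency [th] centred on the run, normalised to be 1 at
   the defects.  The excess 8 / delta of pi / [th] over l keeps the cosine away from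
   0 near the defects, so that its neighbouring values are at most 1 + delta / 2 and
   the killing dominates there; the sites outside [-m, m] count as defects. *)
Lemma bridge_in_le_cos (m l N : nat) (th : R) :
  (forall y : int, (`|y| <= m)%N -> ~ run om p y l) ->
  0 < th -> th * (l%:R + 8 / delta) = pi -> th ^+ 2 <= delta ->
  th * (8 / delta) <= 2 ->
  bridge_in om m N 0 <= (rho * cos th) ^+ N.
Proof.
move=> norun th0 thE thd thC.
have /andP[d0 d1] := delta01.
have C0 : 0 < 8 / delta by rewrite divr_gt0.
have th1 : th <= 1.
  by rewrite -(@ler_pXn2r _ 2%N)// ?nnegrE// ?expr1n ?ltW//; lra.
pose S (x : int) := (m < `|x|)%N || (om x != p).
have Sex x : exists k : nat, S (x + k%:Z).
  by exists (m + `|x| + 1)%N; apply/orP; left; clear; lia.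
have Sex' x : exists k : nat, S (- (x + k%:Z)).
  by exists (m + `|x| + 1)%N; apply/orP; left; clear; lia.
(* [dr x] and [dl x] are the distances from [x] to the nearest point of [S] on the right and, by
   reflection, on the left. *)
have [dr drP] := first_after_exists S Sex.
have [dl' dlP'] := first_after_exists (fun x => S (- x)) Sex'.
pose dl x := dl' (- x).
have dlP x : S (x - (dl x)%:Z) /\ forall i : nat, (i < dl x)%N -> ~~ S (x - i%:Z).
  have [a b] := dlP' (- x); split; first by rewrite /dl -[x]opprK -opprD opprK.
  by move=> i /b; rewrite opprD opprK.
have dr0 x : S x -> dr x = 0%N.
  by move=> Sx; exact: first_after_uniq (drP x) (first_after0 S x Sx).
have dl0 x : S x -> dl x = 0%N.
  move=> Sx; apply: first_after_uniq (dlP' (- x)) (first_after0 _ _ _).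
  by rewrite opprK.
have drS x : ~~ S x -> dr x = (dr (x + 1)).+1.
  by move=> Sx; exact: first_after_uniq (drP x) (first_afterS S x _ Sx (drP _)).
have dlS x : ~~ S x -> dl x = (dl (x - 1)).+1.
  move=> Sx; apply: first_after_uniq (dlP' (- x)) (first_afterS _ _ _ _ _).
    by rewrite opprK.
  by rewrite (_ : - x + 1 = - (x - 1)); [exact: dlP'|rewrite opprB addrC].
(* Off [S], the sites strictly between the two nearest points of [S] form a run of length
   [dl x + dr x - 1] that starts inside the box, so a larger sum would contain a forbidden run. *)
have dlr x : (dl x + dr x <= l)%N.
  case/boolP: (S x) => Sx; first by rewrite dr0// dl0.
  have dx := dlS x Sx; have rx := drS x Sx.
  rewrite leqNgt; apply/negP => lt.
  have nS i : (i < (dl x + dr x).-1)%N -> ~~ S (x - (dl x)%:Z + 1 + i%:Z).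
    move=> i_lt; case: (ltnP i (dl x)) => ix.
      rewrite (_ : _ + i%:Z = x - ((dl x).-1 - i)%N%:Z); last first.
        by clear -ix dx; lia.
      by apply: (dlP x).2; clear -ix dx; lia.
    rewrite (_ : _ + i%:Z = x + (i - (dl x).-1)%N%:Z); last first.
      by clear -ix dx; lia.
    by apply: (drP x).2; clear -ix dx rx i_lt; lia.
  apply: (norun (x - (dl x)%:Z + 1)).
    have : ~~ S (x - (dl x)%:Z + 1 + 0%N%:Z) by apply: nS; clear -lt dx rx; lia.
    by rewrite addr0 /S negb_or -leqNgt => /andP[].
  move=> i il; have : ~~ S (x - (dl x)%:Z + 1 + i%:Z) by apply: nS; clear -lt il; lia.
  by rewrite /S negb_or negbK => /andP[_ /eqP].
(* For distances [a] and [b] to the two ends of a run, (a - b) / 2 is the signed distance to its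
   centre and (a + b) / 2 its half-length: the denominator is the value at the ends. *)
pose f (a b : nat) := cos (th * (a%:R - b%:R) / 2) / cos (th * (a%:R + b%:R) / 2).
pose u x := f (dl x) (dr x).
have thl : th * l%:R + th * (8 / delta) = pi by rewrite -mulrDr.
have thC0 : 0 < th * (8 / delta) by rewrite mulr_gt0.
have ab_bnd (a b : nat) : (a + b <= l)%N -> th * (a%:R + b%:R) / 2 < pi / 2.
  move=> ab; have : th * (a%:R + b%:R) <= th * l%:R.
    by rewrite ler_pM2l// -natrD ler_nat.
  lra.
have cos0 (a b : nat) : (a + b <= l)%N -> 0 < cos (th * (a%:R + b%:R) / 2).
  move=> ab; have h := ab_bnd a b ab.
  have h' : 0 <= th * (a%:R + b%:R) by rewrite mulr_ge0 ?(ltW th0)// -natrD.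
  have pi0 := @pi_gt0 R.
  by apply: cos_gt0_pihalf; rewrite h andbT; lra.
have cos0' (a b : nat) : (a + b <= l)%N -> 0 < cos (th * (a%:R - b%:R) / 2).
  move=> ab; have := ab_bnd a b ab; rewrite mulrDr => h.
  have a0 : 0 <= th * a%:R by rewrite mulr_ge0 ?(ltW th0).
  have b0 : 0 <= th * b%:R by rewrite mulr_ge0 ?(ltW th0).
  by apply: cos_gt0_pihalf; rewrite mulrBr; apply/andP; split; lra.
have u0 x : 0 < u x by rewrite divr_gt0 ?cos0 ?cos0'.
have f1 (a : nat) : (a <= l)%N -> f a 0%N = 1.
  move=> al; have := cos0 a 0%N; rewrite addn0 addr0 => /(_ al) h.
  by rewrite /f subr0 addr0 divff// gt_eqF.
have f1' (b : nat) : (b <= l)%N -> f 0%N b = 1.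
  move=> bl; have := cos0 0%N b; rewrite add0n add0r => /(_ bl) h.
  by rewrite /f sub0r add0r mulrN mulNr cosN divff// gt_eqF.
have uS x : S x -> u x = 1 by move=> Sx; rewrite /u dl0// dr0// f1.
(* If [x + 1] lies in [S], its own distances are 0 whereas the formula measures from the run of [x];
   both give 1, since [f] is 1 when one argument vanishes. *)
have ur x : ~~ S x -> u (x + 1) = f (dl x).+1 (dr x).-1.
  move=> Sx; have := dlr x; rewrite (drS x Sx)/= => dlx.
  case/boolP: (S (x + 1)) => Sx1; last by rewrite /u (dlS _ Sx1) addrK.
  by rewrite uS// dr0// f1//; move: dlx; rewrite dr0//; clear; lia.
have ul x : ~~ S x -> u (x - 1) = f (dl x).-1 (dr x).+1.
  move=> Sx; have := dlr x; rewrite (dlS x Sx)/= => drx.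
  case/boolP: (S (x - 1)) => Sx1; last by rewrite /u (drS _ Sx1) subrK.
  by rewrite uS// dl0// f1'//; move: drx; rewrite dl0//; clear; lia.
have c1 : 1 - delta / 2 <= cos th by have := @cos_ge R th (ltW th0); lra.
have fb (d : nat) : (d.+1 <= l)%N -> f 1%N d <= 1 + delta / 2.
  move=> dl1'; rewrite /f ler_pdivrMr; last by rewrite cos0 ?add1n.
  (* The excess [8 / delta] is the [C] for which the growth factor [1 + 4 / C] equals
     [1 + delta / 2]. *)
  rewrite (_ : delta / 2 = 4 / (8 / delta)); last by field; rewrite gt_eqF.
  rewrite (_ : th * (1 - d%:R) / 2 = - (th * (1 + d%:R) / 2 - th)); last by lra.
  rewrite cosN; apply: (@cos_shift_le R _ _ _ l%:R) => //.
  - by rewrite th0.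
  - by rewrite divr_ge0// mulr_ge0 ?ltW// ltr_pwDl.
  - apply: ler_wpM2r => //; apply: ler_wpM2l; first exact: ltW.
    by rewrite -[1]/(1%:R) -natrD ler_nat.
have fC a b : f a b = f b a.
  by rewrite /f (addrC a%:R b%:R) -(cosN (th * (b%:R - a%:R) / 2)) -mulNr -mulrN opprB.
have unb x : S x -> u (x + 1) <= 1 + delta / 2 /\ u (x - 1) <= 1 + delta / 2.
  move=> Sx; split.
    case/boolP: (S (x + 1)) => Sx1; first by rewrite uS//; lra.
    have := dlr (x + 1); rewrite /u (dlS _ Sx1) addrK dl0//; exact: fb.
  case/boolP: (S (x - 1)) => Sx1; first by rewrite uS//; lra.
  have := dlr (x - 1); rewrite /u (drS _ Sx1) subrK dr0// addn1 fC; exact: fb.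
(* Dividing by [u 0] gives the value 1 at 0, which is at once the terminal condition and the
   constant of the final bound. *)
have := @bridge_in_le R om om01' m (fun x => r ^ x * (u x / u 0)) (rho * cos th).
move=> /(_ _ _ _ _ N 0); rewrite expr0z mul1r divff ?gt_eqF// mulr1; apply.
- by rewrite mulr_ge0 ?(ltW rho0)//; lra.
- move=> x; apply: mulr_ge0; first by rewrite exprz_ge0// ltW.
  by apply: divr_ge0; apply: ltW; exact: u0.
- by [].
move=> x xm.
have scale (a1 a2 b1 b2 u1 u2 K : R) : a1 * (b1 * (u1 * K)) + a2 * (b2 * (u2 * K)) =
    (a1 * (b1 * u1) + a2 * (b2 * u2)) * K by ring.
rewrite scale [r ^ x * _]mulrA [leRHS]mulrA.
apply: ler_wpM2r; first by rewrite invr_ge0 ltW.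
rewrite -mulrA; case/boolP: (S x) => Sx.
  have [h1 h2] := unb x Sx.
  apply: le_trans (tilt_step_le x _ _ _ h1 h2 _) _; first by lra.
  apply: ler_wpM2l; first exact: ltW.
  rewrite uS// mulr1 [leRHS]mulrC; apply: ler_wpM2l.
    by rewrite exprz_ge0 ?ltW.
  move: Sx; rewrite /S ltnNge xm/= => ->; rewrite expr1.
  (* At a defect: (1 - delta)(1 + delta / 2) <= 1 - delta / 2 <= cos th. *)
  apply: le_trans c1; have := mulr_gt0 d0 d0; rewrite mulrDr mulrBl; lra.
have xp : om x = p by move: Sx; rewrite /S negb_or negbK => /andP[_ /eqP].
rewrite tilt_step xp qr (ur x Sx) (ul x Sx) -mulrDr.
rewrite [leRHS](_ : _ = r ^ x * (p * r * (2 * cos th * u x))); last by rewrite /rho; ring.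
apply: ler_wpM2l; first by rewrite exprz_ge0 ?ltW.
apply: ler_wpM2l; first by rewrite ltW// -(pmulr_rgt0 _ (ltr0Sn R 1)) mulrA.
rewrite /u /f (drS x Sx) (dlS x Sx)/=.
set a := dl (x - 1); set b := dr (x + 1).
rewrite (_ : a.+2%:R + b%:R = a.+1%:R + b.+1%:R); last by rewrite -!natrD; congr (_%:R); clear; lia.
rewrite (_ : a%:R + b.+2%:R = a.+1%:R + b.+1%:R); last by rewrite -!natrD; congr (_%:R); clear; lia.
rewrite -mulrDl mulrA; apply: ler_wpM2r.
  by rewrite invr_ge0 ltW// cos0//; have := dlr x; rewrite (drS x Sx) (dlS x Sx).
(* Inside a run the cosine is an exact eigenfunction of the sum over the two neighbours, with
   eigenvalue [2 * cos th]. *)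
rewrite -cosB_add le_eqVlt; apply/orP; left; apply/eqP.
by congr (cos _ + cos _); rewrite -!natr1; field.
Qed.

End Deterministic.

(** * Lower bound from a defect-free run *)

Section LowerBound.
Context {R : realType} (om : int -> R) (p r : R).
Hypotheses (p1 : 2^-1 < p < 1) (r0 : 0 < r) (pr2 : p * r ^+ 2 = 1 - p).
Hypothesis om01 : forall x, 0 < om x < 1.

Let rho := 2 * p * r.

Let om01' x : 0 <= om x <= 1.
Proof. by have /andP[/ltW -> /ltW ->] := om01 x. Qed.

Let rho0 : 0 < rho.
Proof. by rewrite /rho !mulr_gt0//; case/andP: p1; lra. Qed.

Let r1 : r < 1.
Proof. exact: (tilt_lt1 p r p1 pr2). Qed.

Let qr : (1 - p) / r = p * r.
Proof. by rewrite -pr2 expr2 mulrA mulfK// gt_eqF. Qed.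

(* Subsolution: r^x times a cosine centred at j that vanishes at j - h and j + h.
   After the time spent in the run, M steps are kept to come back to 0. *)
Lemma bridge_ge_run (c : R) (j h M n : nat) : 0 < c ->
  (forall x, c <= om x <= 1 - c) ->
  (forall x : int, (`|x - j%:Z| < h)%N -> om x = p) ->
  (0 < h <= j.+1)%N -> (j + h <= M)%N -> (j + M <= 2 * n)%N ->
  (c ^+ 2 * r) ^+ M * (rho * cos (pi / (2 * h%:R))) ^+ (2 * n) <=
  bridge om (2 * n) 0.
Proof.
move=> c0 omc runh /andP[h0 hj] jM jMn.
set th := pi / (2 * h%:R); have hR : 0 < h%:R :> R by rewrite ltr0n.
have thh : th * h%:R = pi / 2 by rewrite /th; field; rewrite gt_eqF.
have th0 : 0 < th by rewrite divr_gt0 ?pi_gt0// mulr_gt0.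
have cosge0 (k : int) : (`|k| <= h)%N -> 0 <= cos (th * k%:~R).
  move=> kh; apply: cos_ge0_pihalf; rewrite -thh -ler_norml normrM (gtr0_norm th0).
  by rewrite ler_pM2l// -intr_norm -[h%:R]/(h%:Z%:~R) ler_int; clear -kh; lia.
have lam0 : 0 <= rho * cos th.
  by rewrite mulr_ge0 ?(ltW rho0)// -[th]mulr1 (cosge0 1).
have lam1 : rho * cos th <= 1.
  apply: le_trans (rho_le1 p r p1 r0 pr2); rewrite ler_piMr ?(ltW rho0)//; exact: cos_le1.
pose D (x : int) := (`|x - j%:Z| < h)%N.
pose psi (x : int) := r ^ x * cos (th * (x - j%:Z)%:~R).
pose phi (x : int) := if D x then c ^+ M * psi x else 0.
(* At distance exactly [h] the cosine vanishes, so the cutoff is invisible from the neighbours of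
   [D] and the eigenvalue equation survives on [D]. *)
have psiE x : (`|x - j%:Z| <= h)%N -> phi x = c ^+ M * psi x.
  move=> xh; rewrite /phi; case: ifPn => // Dx.
  rewrite /psi (_ : cos _ = 0) ?mulr0//.
  have [->|->] : x - j%:Z = h%:Z \/ x - j%:Z = - h%:Z by move: Dx; rewrite /D; clear -xh; lia.
    by rewrite thh cos_pihalf.
  by rewrite mulrNz mulrN cosN thh cos_pihalf.
have phij : phi j%:Z = c ^+ M * r ^ j%:Z.
  by rewrite /phi /D /psi subrr absz0 h0 mulr0 cos0 mulr1.
have sub : (rho * cos th) ^+ (2 * n - j - M) * (c ^+ M * r ^ j%:Z) <=
    bridge om (2 * n - j) j%:Z.
  have -> : (2 * n - j = (2 * n - j - M) + M)%N by clear -jMn; lia.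
  rewrite -phij addnK; apply: (@bridge_ge_sub R om om01' D) => //.
  - by move=> x Dx; rewrite /phi (negbTE Dx).
  - move=> x Dx xo; rewrite /phi Dx.
    apply: le_trans (bridge_ge_exp om om01' c (ltW c0) omc M x _ xo); last first.
      by move: Dx; rewrite /D; clear -jM; lia.
    rewrite -[leRHS]mulr1; apply: ler_wpM2l; first by rewrite exprn_ge0 ?ltW.
    (* [h <= j.+1] keeps [D] in the nonnegative sites, where [r ^ x] is at most 1; this bounds [psi]
       by 1 at the terminal time. *)
    have x0 : 0 <= x by move: Dx; rewrite /D; clear -hj; lia.
    rewrite /psi mulr_ile1 ?cos_le1 ?cosge0 ?exprz_ge0 ?(ltW r0)//.
      by exact: ltnW.
    by case: x x0 {Dx xo} => // k _; rewrite exprn_ile1 ?ltW.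
  - move=> x Dx; rewrite {1}/phi Dx.
    rewrite !psiE; [|by move: Dx; rewrite /D; clear; lia|by move: Dx; rewrite /D; clear; lia].
    rewrite !(mulrCA _ (c ^+ M)) -mulrDr; apply: ler_wpM2l.
      by rewrite exprn_ge0 ?ltW.
    rewrite /psi (tilt_step om r r0) (runh x Dx) qr -mulrDr.
    rewrite [x + 1 - _]addrAC [x - 1 - _]addrAC.
    rewrite (intrD R (x - j%:Z) 1) (intrB R (x - j%:Z) 1).
    rewrite (mulrDr th) (mulrBr th) !mulr1 cosB_add /rho.
    by rewrite le_eqVlt; apply/orP; left; apply/eqP; ring.
  - by clear -jMn; lia.
have h1 := bridge_ge_right om om01' c (ltW c0) omc j (2 * n - j) 0.
rewrite add0r subnKC in h1; last by clear -jMn; lia.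
apply: le_trans h1; apply: le_trans (ler_wpM2l _ sub); last by rewrite exprn_ge0 ?ltW.
have c1 : c <= 1 by have /andP[] := omc 0; lra.
rewrite exprMn -exprM !mul2n -!addnn (exprD c).
(* All bases are at most 1, so the exponents may be enlarged to [M] and [2 * n]. *)
have e1 : c ^+ M <= c ^+ j by apply: ler_wiXn2l; rewrite ?(ltW c0)//; clear -jM; lia.
have e2 : r ^+ M <= r ^+ j by apply: ler_wiXn2l; rewrite ?(ltW r0) ?(ltW r1)//; clear -jM; lia.
have e3 : (rho * cos th) ^+ (n + n) <= (rho * cos th) ^+ (n + n - j - M).
  by apply: ler_wiXn2l => //; clear; lia.
rewrite -[r ^ j%:Z]/(r ^+ j).
rewrite [leRHS](_ : _ = c ^+ j * c ^+ M * r ^+ j * (rho * cos th) ^+ (n + n - j - M)); last by ring.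
have cM j' : 0 <= c ^+ j' by rewrite exprn_ge0 ?ltW.
have rM j' : 0 <= r ^+ j' by rewrite exprn_ge0 ?ltW.
apply: ler_pM => //; first by rewrite !mulr_ge0.
  by rewrite exprn_ge0.
apply: ler_pM => //; rewrite ?mulr_ge0//.
by apply: ler_wpM2r.
Qed.

End LowerBound.

(** * Quenched probabilities as path weights *)

(** Discrete intermediate value property: with steps of size 1, a path started within distance [m]
    cannot jump over both [m] and [- m]. *)
Lemma neighbour_path_hits (m : nat) (x : int) (s : seq int) :
  (`|x| <= m)%N -> path neighbour x s ->
  has (fun y : int => (m <= `|y|)%N) (x :: s) ->
  (m%:Z \in x :: s) || (- m%:Z \in x :: s).
Proof.
elim: s x => [|y s IH] x xm.
  by rewrite /= orbF !inE => _ mx; apply/orP; lia.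
rewrite /= => /andP[xy ys].
have [e|ne] := eqVneq `|x|%N m.
  by move=> _; rewrite !inE; apply/orP; case: (leP 0 x) => ?; [left|right];
    apply/orP; left; lia.
rewrite leqNgt ltn_neqAle ne xm/= => h.
have ym : (`|y| <= m)%N by move: xy; rewrite /neighbour; lia.
by case/orP: (IH y ym ys h) => h'; apply/orP; [left|right]; rewrite in_cons h' orbT.
Qed.

Section QuenchedLaw.
Context {R : realType} (w : environment R) (Q : probability trajectory R).
Hypothesis hQ : quenched_law w Q.

Let om (x : int) : R := site x w.

Lemma site_oo x : 0 < om x < 1.
Proof. by rewrite /om /site; case: (w x). Qed.

Let om01 x : 0 <= om x <= 1.
Proof. by have /andP[/ltW -> /ltW ->] := site_oo x. Qed.

Lemma measurable_trajectory_eq (n : nat) (y : int) :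
  measurable ([set X | X n = y] : set trajectory).
Proof. by apply: sub_sigma_algebra; exists n, y. Qed.

Lemma measurable_trajectory_event (m N : nat) (g : pred (seq int)) :
  measurable ([set X | g (mkseq (fun i => X (m + i)%N) N)] : set trajectory).
Proof.
elim: N m g => [|N IH] m g.
  rewrite /mkseq/=; case: (g _).
    by rewrite set_true.
  by rewrite set_false.
rewrite (_ : [set X | _] = \bigcup_(y : int) ([set X : trajectory | X m = y] `&`
   [set X | g (y :: mkseq (fun i => X (m.+1 + i)%N) N)])).
  apply: countable_bigcupT_measurable => // y.
  apply: measurableI; first exact: measurable_trajectory_eq.
  exact: (IH m.+1 (fun s => g (y :: s))).
have E (X : nat -> int) : mkseq (fun i => X (m + i)%N) N.+1 =
    X m :: mkseq (fun i => X (m.+1 + i)%N) N.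
  rewrite /mkseq/= addn0; congr cons; rewrite (iotaDl 1 0) -map_comp.
  by apply: eq_map => i /=; rewrite addnA addn1.
apply/seteqP; split => X /=; rewrite E; first by exists (X m).
by move=> [y _ [/= <-]].
Qed.

Let past (h : nat -> int) n : set trajectory :=
  [set X | forall k, (k <= n)%N -> X k = h k].

Let measurable_past h n : measurable (past h n).
Proof.
rewrite (_ : past h n = \bigcap_(k in [set k | (k <= n)%N]) [set X | X k = h k]).
  by apply: bigcap_measurableType => k _; exact: measurable_trajectory_eq.
by apply/seteqP; split => X.
Qed.

Let mu (A : set trajectory) : R := fine (Q A).

Let mu_ge0 A : 0 <= mu A.
Proof. by rewrite fine_ge0. Qed.

Let muU A B : measurable A -> measurable B -> A `&` B = set0 ->
  mu (A `|` B) = mu A + mu B.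
Proof.
by move=> mA mB AB; rewrite /mu measureU// fineD// fin_num_measure.
Qed.

Let mu_le A B : measurable A -> measurable B -> A `<=` B -> mu A <= mu B.
Proof.
by move=> mA mB AB; rewrite /mu fine_le ?fin_num_measure// le_measure ?inE.
Qed.

(** Product form of the transition rule, free of its condition on the past: for a null past both
    sides are 0. *)
Let mu_step h n y : mu ([set X | X n.+1 = y] `&` past h n) =
  jump w (h n) y * mu (past h n).
Proof.
have [Q0|Q0] := eqVneq (Q (past h n)) 0%E.
  rewrite [mu (past _ _)]/mu Q0/= mulr0; apply/eqP; rewrite eq_le mu_ge0 andbT.
  rewrite -[leRHS]/(fine 0%E) -Q0; apply: mu_le => //.
  by apply: measurableI => //; exact: measurable_trajectory_eq.
have := hQ.2 n h y Q0; rewrite /cond_prob -/(past h n) => <-.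
by rewrite -/(mu _) -/(mu (past h n)) mulfVK// /mu fine_eq0 ?fin_num_measure.
Qed.

(** The transition rule speaks of complete histories only, so the induction carries the whole past
    although the path weight depends on [h n] alone. *)
Lemma quenched_law_past (N n : nat) (h : nat -> int) (g : pred (seq int)) :
  mu (past h n `&` [set X | g (mkseq (fun i => X (n.+1 + i)%N) N)]) =
  mu (past h n) * pathsum om N (h n) g.
Proof.
elim: N n h g => [|N IH] n h g.
  rewrite /mkseq/=; case: (g [::]).
    by rewrite mulr1 set_true setIT.
  by rewrite mulr0 set_false setI0 /mu measure0.
pose G : set trajectory := [set X | g (mkseq (fun i => X (n.+1 + i)%N) N.+1)].
rewrite -[X in _ `&` X]/G.
pose E y := [set X : trajectory | X n.+1 = y].
have mE y : measurable (E y) by exact: measurable_trajectory_eq.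
have mG : measurable G by exact: measurable_trajectory_event.
have ne : h n + 1 <> h n - 1 by lia.
have EE : E (h n + 1) `&` E (h n - 1) = set0.
  by apply/seteqP; split => X // -[e1 e2]; apply: ne; rewrite -e1.
pose U := E (h n + 1) `|` E (h n - 1).
have mU : measurable U by exact: measurableU.
have split3 A : measurable A -> mu (past h n `&` A) =
    mu (E (h n + 1) `&` past h n `&` A) + mu (E (h n - 1) `&` past h n `&` A) +
    mu (past h n `&` A `&` ~` U).
  move=> mA; have mPA := measurableI _ _ (measurable_past h n) mA.
  rewrite -{1}(setIT (past h n `&` A)) -(setUv U) setIUr muU; last 1 first.
  - by rewrite setIACA setICr setI0.
  - rewrite /U setIUr muU.
    + by congr (mu _ + mu _ + _); rewrite setIC setIA.
    + exact: measurableI.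
    + exact: measurableI.
    + by rewrite setIACA EE setI0.
  - exact: measurableI.
  - by apply: measurableI => //; exact: measurableC.
(* The two jump probabilities sum to 1, which leaves no mass for the other sites. *)
have null : mu (past h n `&` ~` U) = 0.
  have := split3 setT measurableT; rewrite !setIT !mu_step /jump eqxx.
  rewrite (_ : h n - 1 == h n + 1 = false); last by apply/eqP; exact/nesym.
  rewrite eqxx; lra.
have nullG : mu (past h n `&` G `&` ~` U) = 0.
  apply/eqP; rewrite eq_le mu_ge0 andbT -null; apply: mu_le.
  - by apply: measurableI; [exact: measurableI|exact: measurableC].
  - by apply: measurableI => //; exact: measurableC.
  - by move=> X [[? ?] ?].
rewrite split3// nullG addr0.
have mkS (X : nat -> int) : mkseq (fun i => X (n.+1 + i)%N) N.+1 =
    X n.+1 :: mkseq (fun i => X (n.+2 + i)%N) N.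
  rewrite /mkseq/= addn0; congr cons; rewrite (iotaDl 1 0) -map_comp.
  by apply: eq_map => i /=; rewrite addnA addn1.
have step y : mu (E y `&` past h n `&` G) =
    jump w (h n) y * mu (past h n) * pathsum om N y (fun s => g (y :: s)).
  pose h' k := if (k <= n)%N then h k else y.
  have pE : E y `&` past h n = past h' n.+1.
    apply/seteqP; split => X /=.
      move=> [Xy Xh] k kn'; rewrite /h'; case: (leqP k n) => kn; first exact: Xh.
      by rewrite (_ : k = n.+1)//; apply/eqP; rewrite eqn_leq kn' kn.
    move=> H; split; first by rewrite /E/= H// /h' ltnn.
    by move=> k kn; rewrite H ?leqW// /h' kn.
  rewrite -mu_step -/(E y) pE; have := IH n.+1 h' (fun s => g (y :: s)).
  rewrite (_ : h' n.+1 = y); last by rewrite /h' ltnn.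
  move=> <-; congr (mu _); by rewrite -pE; apply/seteqP; split => X [XE XG];
    (split; first exact: XE); move: XG; rewrite /G/= mkS (XE.1 : X n.+1 = y).
rewrite !step /jump eqxx.
rewrite (_ : h n - 1 == h n + 1 = false); last by apply/eqP; exact/nesym.
by rewrite eqxx/= -/(om _); ring.
Qed.

Lemma quenched_law_pathsum (N : nat) (g : pred (seq int)) :
  fine (Q [set X | g (mkseq X N.+1)]) = pathsum om N 0 (fun s => g (0 :: s)).
Proof.
pose A : set trajectory := [set X | X 0%N = 0].
have mA : measurable A by exact: measurable_trajectory_eq.
pose G : set trajectory := [set X | g (mkseq X N.+1)].
have mG : measurable G.
  exact: (measurable_trajectory_event 0 N.+1 g).
have A1 : mu A = 1 by rewrite /mu hQ.1.
have null : mu (~` A) = 0.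
  have := muU _ _ mA (measurableC mA) (setICr A); rewrite setUv A1 /mu probability_setT/=.
  lra.
have e : mu G = mu (A `&` G).
  rewrite -{1}(setIT G) -(setUv A) setIUr muU.
  - rewrite [X in _ + X = _](_ : _ = 0) ?addr0 1?setIC//.
    apply/eqP; rewrite eq_le mu_ge0 andbT -null; apply: mu_le.
    + by apply: measurableI => //; exact: measurableC.
    + exact: measurableC.
    + by move=> X [].
  - exact: measurableI.
  - by apply: measurableI => //; exact: measurableC.
  - by rewrite setIACA setICr setI0.
rewrite -[LHS]/(mu G) e.
have := quenched_law_past N 0 (fun=> 0) (fun s => g (0 :: s)).
have -> : past (fun=> 0) 0 = A.
  by apply/seteqP; split => X /=; [exact|move=> ? k; rewrite leqn0 => /eqP ->].
rewrite A1 mul1r => <-; congr (mu _).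
have mkS (X : nat -> int) : mkseq X N.+1 = X 0%N :: mkseq (fun i => X (1 + i)%N) N.
  by rewrite /mkseq/= (iotaDl 1 0) -map_comp.
by apply/seteqP; split => X [X0 XG]; (split; first exact: X0); move: XG;
  rewrite /G/= mkS (X0 : X 0%N = 0).
Qed.

Lemma max_abs_mkseq (X : trajectory) N :
  max_abs X N = (\max_(y <- mkseq X N.+1) `|y|)%N.
Proof. by rewrite /max_abs /mkseq big_map -[iota _ _]/(index_iota 0 N.+1) big_mkord. Qed.

Lemma last_mkseq (X : trajectory) N : last 0 (mkseq X N.+1) = X N.
Proof. by rewrite (last_nth 0) size_mkseq -[LHS]/(nth 0 (mkseq X N.+1) N) nth_mkseq. Qed.

Lemma quenched_bridge N : fine (Q [set X | X N = 0]) = bridge om N 0.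
Proof.
have := quenched_law_pathsum N (fun s => last 0 s == 0).
rewrite /bridge => <-; congr (fine (Q _)).
by apply/seteqP; split => X; rewrite /mkset last_mkseq => /eqP.
Qed.

Let quenched_max (a : R) N :
  fine (Q ([set X | a <= (max_abs X N)%:R] `&` [set X | X N = 0])) =
  pathsum om N 0 (fun s => (a <= (\max_(y <- 0%R :: s) `|y|)%N%:R) && (last 0 s == 0)).
Proof.
have := quenched_law_pathsum N
  (fun s => (a <= (\max_(y <- s) `|y|)%N%:R) && (last 0 s == 0)).
move=> <-; congr (fine (Q _)).
apply/seteqP; split => X; rewrite /setI /mkset max_abs_mkseq last_mkseq.
  by move=> [-> ->]; rewrite eqxx.
by move=> /andP[-> /eqP].
Qed.

Lemma cond_prob_max_le (a : R) (m N : nat) : (forall k : nat, a <= k%:R -> (m <= k)%N) ->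
  cond_prob Q [set X | a <= (max_abs X N)%:R] [set X | X N = 0] <=
  (bridge_hit om m%:Z N 0 + bridge_hit om (- m%:Z) N 0) / bridge om N 0.
Proof.
move=> am; rewrite /cond_prob quenched_bridge quenched_max.
apply: ler_wpM2r; first by rewrite invr_ge0 bridge_ge0.
apply: le_trans (pathsumU_le om om01 _ _ _ _).
apply: pathsum_le_path => // s _ s0 /andP[/am ms l0].
rewrite -andb_orl l0 andbT; apply: neighbour_path_hits => //.
apply: contraTT ms => /hasPn h; rewrite -ltnNge.
have [m0|m0] := posnP m; first by have := h 0 (mem_head _ _); rewrite m0.
rewrite -[in X in (_ < X)%N](prednK m0) ltnS.
by apply/bigmax_leqP_seq => y ys _; rewrite -ltnS prednK// ltnNge; exact: h.
Qed.

Lemma cond_prob_max_ge (a : R) (m N : nat) : 0 < bridge om N 0 ->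
  (forall k : nat, k%:R < a -> (k <= m)%N) ->
  1 - bridge_in om m N 0 / bridge om N 0 <=
  cond_prob Q [set X | a <= (max_abs X N)%:R] [set X | X N = 0].
Proof.
move=> b0 am; rewrite /cond_prob quenched_bridge quenched_max.
rewrite lerBlDr -mulrDl ler_pdivlMr// mul1r addrC.
apply: le_trans (pathsumU_le om om01 _ _ _ _).
apply: pathsum_le => // s ls; rewrite -andb_orl ls andbT.
case: leP => [|/am h]; first by rewrite orbT.
rewrite orbF; apply/allP => y ys; apply: leq_trans h.
by rewrite (big_rem y)//= leq_maxl.
Qed.

Lemma cond_prob_ge0 A B : 0 <= cond_prob Q A B.
Proof. by rewrite divr_ge0// fine_ge0. Qed.

Lemma cond_prob_max_le1 (a : R) (N : nat) : 
  cond_prob Q [set X | a <= (max_abs X N)%:R] [set X | X N = 0] <= 1.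
Proof.
rewrite /cond_prob quenched_bridge quenched_max.
(* A null conditioning event gives the value 0 by the convention for division. *)
have [->|b0] := eqVneq (bridge om N 0) 0; first by rewrite invr0 mulr0.
rewrite ler_pdivrMr ?mul1r ?lt0r ?b0 ?bridge_ge0//.
by apply: pathsum_le => // s /andP[].
Qed.

End QuenchedLaw.

(** * Almost sure properties of the environment *)

Lemma borel_cantelli_geometric d (T : measurableType d) (R : realType)
    (P : probability T R) (E : (set T)^nat) (C q : R) :
  (forall k, measurable (E k)) -> 0 <= C -> 0 < q < 1 ->
  (forall k, (P (E k) <= (C * q ^+ k)%:E)%E) ->
  {ae P, forall w, \forall k \near \oo, ~ E k w}.
Proof.
move=> mE C0 /andP[q0 q1] PE.
have q1' : `|q| < 1 by rewrite gtr0_norm.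
have lim0 : P (lim_sup_set E) = 0%E.
  apply: lim_sup_set_cvg0 => //.
  apply: (@le_lt_trans _ _ (C * (1 - q)^-1)%:E); last by rewrite ltry.
  apply: lime_le; first exact: is_cvg_nneseries.
  apply: nearW => n; apply: (@le_trans _ _ (series (geometric C q) n)%:E); last first.
    by rewrite lee_fin; exact: geometric_le_lim.
  by rewrite /series/= -sumEFin; apply: lee_sum => i _; exact: PE.
exists (lim_sup_set E); split=> //.
  by apply: bigcap_measurableType => k _; apply: bigcup_measurable => j _.
move=> w /= H n _; apply: contrapT => nE; apply: H.
by exists n => // k /= nk Ek; apply: nE; exists k.
Qed.

Section RandomEnvironment.
Context {R : realType} (P : probability (environment R) R) (p alpha : R).
Hypothesis hindep : mutually_independent P (@site R).
Hypothesis halpha : forall x, P [set w | site x w = p] = alpha%:E.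
Hypothesis alpha01 : 0 < alpha < 1.

Lemma measurable_site_preimage (x : int) (B : set R) : measurable B ->
  measurable ([set w | B (site x w)] : set (environment R)).
Proof. by move=> mB; apply: sub_sigma_algebra; exists x, B. Qed.

Definition all_min (s : seq int) : set (environment R) :=
  [set w | forall x, x \in s -> site x w = p].

Lemma measurable_all_min s : measurable (all_min s).
Proof.
elim: s => [|x s IH].
  by rewrite (_ : all_min _ = setT)//; apply/seteqP; split.
rewrite (_ : all_min _ = [set w | site x w = p] `&` all_min s).
  apply: measurableI => //.
  by apply: (measurable_site_preimage x [set p]); exact: measurable_set1.
apply/seteqP; split => w /=.
  by move=> H; split=> [|y ys]; apply: H; rewrite inE ?eqxx ?ys ?orbT.
by move=> [xp H] y; rewrite inE => /orP[/eqP ->|/H].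
Qed.

Lemma prob_all_min s : uniq s -> P (all_min s) = (alpha ^+ size s)%:E.
Proof.
move=> us; have := hindep s (fun=> [set p]) us (fun=> measurable_set1 p).
rewrite -/(all_min s) (eq_bigr (fun=> alpha)); last first.
  by move=> x _; rewrite (_ : _ @^-1` _ = [set w | site x w = p])// halpha.
rewrite big_const_seq count_predT iter_mulr mulr1 => <-.
by rewrite fineK// fin_num_measure//; exact: measurable_all_min.
Qed.

(* Independence is only assumed for events, so the product is expanded over the
   sets of sites required to be defect-free. *)
Lemma integral_damping (e : nat -> int) (delta : R) (k : nat) : injective e ->
  0 <= delta <= 1 ->
  measurable_fun setT (EFin \o (fun w : environment R =>
    (1 - delta) ^+ defects (fun x => site (e `|x|%N) w) p k)) /\
  (\int[P]_w ((1 - delta) ^+ defects (fun x => site (e `|x|%N) w) p k)%:E =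
   ((1 - delta + delta * alpha) ^+ k)%:E)%E.
Proof.
move=> ie /andP[d0 d1].
pose S (f : {ffun 'I_k -> bool}) := [seq e i | i : 'I_k <- enum 'I_k & f i].
pose c (f : {ffun 'I_k -> bool}) := \prod_i (if f i then delta else 1 - delta).
have c0 f : 0 <= c f by apply: prodr_ge0 => i _; case: ifP => _; lra.
have uS f : uniq (S f).
  rewrite map_inj_uniq; first by apply: filter_uniq; exact: enum_uniq.
  by move=> i j /ie ij; exact: val_inj.
have expand w : (1 - delta) ^+ defects (fun x => site (e `|x|%N) w) p k =
    \sum_f c f * \1_(all_min (S f)) w.
  rewrite /defects expr_sum/=.
  (* Each factor is written as [1 - delta] plus [delta] times the indicator that the site has value
     [p]; [f] selects the sites where the second term is taken. *)
  transitivity (\prod_(i < k) \sum_(b : bool)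
      if b then delta * (site (e i) w == p)%:R else 1 - delta).
    apply: eq_bigr => i _; rewrite big_bool/=; case: (_ == _) => /=.
      by rewrite expr0 mulr1; lra.
    by rewrite expr1 mulr0 add0r.
  rewrite bigA_distr_bigA; apply: eq_bigr => f _; rewrite indicE.
  case: (boolP (w \in all_min (S f))) => [/set_mem H|/negP nH].
    rewrite mulr1; apply: eq_bigr => i _; case: ifP => // fi.
    rewrite H ?eqxx ?mulr1//; apply/mapP; exists i => //.
    by rewrite mem_filter fi mem_enum.
  rewrite mulr0; have /existsNP[x /not_implyP[/mapP[i + ->] ne]] :
      ~ all_min (S f) w by move=> H; apply: nH; exact: mem_set.
  rewrite mem_filter => /andP[fi _].
  by rewrite (bigD1 i)//= fi (negbTE (introN eqP ne)) mulr0 mul0r.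
have mI f : measurable_fun setT (EFin \o (fun w => c f * \1_(all_min (S f)) w)).
  apply/measurable_EFinP; apply: measurable_funM => //.
  by apply: measurable_indic; exact: measurable_all_min.
split.
  apply/measurable_EFinP; rewrite (funext expand); apply: measurable_sum => f.
  by apply/measurable_EFinP; exact: mI.
under eq_integral do rewrite expand -sumEFin.
rewrite ge0_integral_sum//; last first.
  by move=> f w _; rewrite lee_fin mulr_ge0// indicE.
transitivity (\sum_(f : {ffun 'I_k -> bool}) (c f * alpha ^+ size (S f))%:E)%E.
  apply: eq_bigr => f _.
  under eq_integral do rewrite EFinM.
  rewrite ge0_integralZl_EFin//; last first.
    by apply/measurable_EFinP; apply: measurable_indic; exact: measurable_all_min.
  rewrite integral_indic//; last exact: measurable_all_min.
  by rewrite setIT [X in (_ * X)%E](prob_all_min _ (uS f)).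
rewrite sumEFin; congr (_%:E).
have -> : (1 - delta + delta * alpha) ^+ k =
    \prod_(i < k) (1 - delta + delta * alpha) by rewrite prodr_const card_ord.
transitivity (\prod_(i < k) \sum_(b : bool)
    if b then delta * alpha else 1 - delta).
  rewrite bigA_distr_bigA; apply: eq_bigr => f _.
  have -> : size (S f) = (\sum_i f i)%N.
    rewrite /S size_map size_filter -sum1_count big_mkcond big_enum/=.
    by apply: eq_bigr => i _; case: (f i).
  rewrite expr_sum -big_split/=; apply: eq_bigr => i _.
  by case: (f i); rewrite ?expr1// expr0 mulr1.
by apply: eq_bigr => i _; rewrite big_bool/= addrC.
Qed.

(** Exponential moment bound. The mean is [sigma ^+ k] with [sigma < 1], and [tau = (1 + sigma) / 2]
    satisfies [sigma <= tau ^+ 2], so Markov's inequality at level [tau ^+ k] leaves the summable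
    [tau ^+ k]. The embedding [e] covers both half-lines. *)
Lemma ae_damping (e : nat -> int) (delta : R) : injective e -> 0 < delta < 1 ->
  exists2 tau : R, 0 < tau < 1 & {ae P, forall w, \forall k \near \oo,
    (1 - delta) ^+ defects (fun x => site (e `|x|%N) w) p k <= tau ^+ k}.
Proof.
move=> ie /andP[d0 d1]; have /andP[a0 a1] := alpha01.
have dab : 0 < delta * (1 - alpha) by rewrite mulr_gt0// subr_gt0.
have dab1 : delta * (1 - alpha) < 1 by rewrite mulr_ilt1 ?subr_ge0 ?ltW//; lra.
pose sigma := 1 - delta + delta * alpha.
have sE : sigma = 1 - delta * (1 - alpha) by rewrite /sigma; ring.
pose tau := (1 + sigma) / 2.
have t01 : 0 < tau < 1 by rewrite /tau sE; apply/andP; split; lra.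
have /andP[t0 t1] := t01.
have st : sigma <= tau ^+ 2.
  have := sqr_ge0 (1 - sigma); rewrite /tau; nra.
exists tau => //.
pose f k (w : environment R) := (1 - delta) ^+ defects (fun x => site (e `|x|%N) w) p k.
have f0 k w : 0 <= f k w by rewrite exprn_ge0//; lra.
have d01 : 0 <= delta <= 1 by rewrite !ltW.
pose E k := [set w : environment R | ((tau ^+ k)%:E <= `|(EFin \o f k) w|)%E].
have mE k : measurable (E k).
  rewrite -[E k]setTI; apply: emeasurable_fun_c_infty => //.
  by apply: measurableT_comp => //; exact: (integral_damping e delta k ie d01).1.
have PE k : (P (E k) <= (1 * tau ^+ k)%:E)%E.
  have [mf intf] := integral_damping e delta k ie d01.
  have tk : 0 < tau ^+ k by rewrite exprn_gt0.
  have := le_integral_abse P measurableT mf tk; rewrite setTI -/(E k).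
  under eq_integral do rewrite /= ger0_norm ?f0//.
  rewrite intf -/sigma => h.
  rewrite -(@lee_pmul2l _ (tau ^+ k)%:E) ?lte_fin//.
  apply: le_trans h _; rewrite -EFinM lee_fin mul1r -expr2 -exprM mulnC exprM.
  by apply: lerXn2r; rewrite ?nnegrE ?exprn_ge0 ?(ltW t0)// sE; lra.
have := borel_cantelli_geometric _ _ _ P E 1 tau mE ler01 t01 PE.
apply: filterS => w; apply: filterS => k /negP.
by rewrite /E/= -ltNge lte_fin ger0_norm// => /ltW.
Qed.

Let b : R := - ln alpha.

Let b0 : 0 < b.
Proof. by rewrite /b oppr_gt0 ln_lt0. Qed.

Let alphaX n : alpha ^+ n = expR (- (b * n%:R)).
Proof.
have /andP[a0 a1] := alpha01.
by rewrite /b mulNr opprK expRM_natr lnK.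
Qed.

Lemma all_min_run w y l :
  all_min [seq y + i%:Z | i <- iota 0 l] w <-> run (fun x => site x w) p y l.
Proof.
split=> [H i il|H x /mapP[i]]; last by rewrite mem_iota => il ->; exact: H.
by apply: H; apply/mapP; exists i => //; rewrite mem_iota.
Qed.

Let uniq_interval (y : int) l : uniq [seq y + i%:Z | i <- iota 0 l].
Proof. by rewrite map_inj_uniq ?iota_uniq// => i j /addrI[]. Qed.

(** Union bound: at most 3 e^k starting points, each opening such a run with probability at most
    e^(- s k). *)
Lemma ae_short_runs (s : R) : 1 < s ->
  {ae P, forall w, \forall k \near \oo, forall y : int,
    (`|y| <= Num.truncn (expR k%:R : R))%N ->
    ~ run (fun x => site x w) p y (Num.truncn (s * k%:R / (- ln alpha))).+1}.
Proof.
move=> s1; rewrite -/b.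
pose m k := Num.truncn (expR k%:R : R); pose l k := (Num.truncn (s * k%:R / b)).+1.
pose A k i := all_min [seq i%:Z - (m k)%:Z + j%:Z | j <- iota 0 (l k)].
have mA k i : measurable (A k i) by exact: measurable_all_min.
pose E k := \big[setU/set0]_(i < (2 * m k).+1) A k i.
have mE k : measurable (E k) by exact: bigsetU_measurable.
pose q := expR (- (s - 1)).
have q01 : 0 < q < 1 by rewrite expR_gt0 expR_lt1 oppr_lt0 subr_gt0.
have PE k : (P (E k) <= (3 * q ^+ k)%:E)%E.
  have boole : (P (E k) <= \sum_(i < (2 * m k).+1) P (A k i))%E.
    by apply: Boole_inequality => i _; exact: mA.
  apply: le_trans boole _.
  rewrite (eq_bigr (fun=> (alpha ^+ l k)%:E)); last first.
    by move=> i _; rewrite prob_all_min// size_map size_iota.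
  rewrite sumEFin lee_fin sumr_const card_ord -[leLHS]mulr_natl.
  have h1 : alpha ^+ l k <= expR (- (s * k%:R)).
    rewrite alphaX ler_expR lerN2 [b * _]mulrC -ler_pdivrMr//; apply: ltW.
    by rewrite /l; exact: truncnS_gt.
  have h2 : (2 * m k).+1%:R <= 3 * expR k%:R :> R.
    have : (m k)%:R <= expR k%:R :> R by rewrite truncn_le expR_ge0.
    have : 1 <= expR k%:R :> R by rewrite -expR0 ler_expR.
    rewrite -natr1 natrM; lra.
  have -> : 3 * q ^+ k = 3 * expR k%:R * expR (- (s * k%:R)).
    rewrite -mulrA -expRD /q -expRM_natr; congr (_ * expR _); ring.
  by apply: ler_pM => //; rewrite alphaX expR_ge0.
have := borel_cantelli_geometric _ _ _ P E 3 q mE _ q01 PE.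
move=> /(_ (ler0n _ _)); apply: filterS => w; apply: filterS => k nE y ym yrun; apply: nE.
have ei : (absz (y + (m k)%:Z))%:Z - (m k)%:Z = y.
  by move: ym; rewrite -/(m k); move: (m k) => M; clear; lia.
rewrite /E -bigcup_mkord; exists (absz (y + (m k)%:Z)).
  by move: ym; rewrite -/(m k) /=; move: (m k) => M; clear; lia.
by rewrite /A ei; apply/all_min_run.
Qed.

(** The extra sites [s] make the induction close: excluding a full block is a difference of two
    probabilities, and in the subtracted one the block is appended to [s]. Only events of the form
    [all_min] have to be evaluated. *)
Lemma prob_no_full_block (L : nat) (blk : nat -> seq int) (ts : seq nat) (s : seq int) :
  uniq (s ++ flatten (map blk ts)) -> (forall t, size (blk t) = L) ->
  let N := [set w | forall t, t \in ts -> ~ all_min (blk t) w] in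
  measurable N /\
  P (all_min s `&` N) = (alpha ^+ size s * (1 - alpha ^+ L) ^+ size ts)%:E.
Proof.
move=> us sL; elim: ts s us => [|t ts IH] s us /=.
  have -> : [set w | forall t, t \in [::] -> ~ all_min (blk t) w] = setT.
    by apply/seteqP; split.
  by rewrite setIT expr0 mulr1 prob_all_min//; move: us; rewrite cats0.
set N := [set w | forall u, u \in ts -> ~ all_min (blk u) w].
have us1 : uniq (s ++ flatten (map blk ts)).
  move: us; rewrite /= !cat_uniq => /and3P[-> h1 /and3P[_ _ ->]]; rewrite andbT.
  by apply: contra h1; rewrite has_cat => ->; rewrite orbT.
have us2 : uniq ((s ++ blk t) ++ flatten (map blk ts)) by rewrite -catA.
have [mN PN] := IH _ us1; have [_ PN2] := IH _ us2.
have mt := measurable_all_min (blk t).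
have -> : [set w | forall u, u \in t :: ts -> ~ all_min (blk u) w] = N `\` all_min (blk t).
  apply/seteqP; split => w /=.
    by move=> H; split=> [u uts|]; apply: H; rewrite inE ?eqxx ?uts ?orbT.
  by move=> [H Ht] u; rewrite inE => /orP[/eqP ->|/H].
split; first exact: measurableD.
have mX : measurable (all_min s `&` N) by apply: measurableI => //; exact: measurable_all_min.
rewrite setDE setIA -setDE measureD//; last first.
  by apply: le_lt_trans (probability_le1 P mX) _; rewrite ltry.
have -> : all_min s `&` N `&` all_min (blk t) = all_min (s ++ blk t) `&` N.
  apply/seteqP; split => w /=.
    move=> [[H1 H2] H3]; split=> // x; rewrite mem_cat => /orP[]; [exact: H1|exact: H3].
  by move=> [H1 H2]; split; [split=> //|] => x xs; apply: H1; rewrite mem_cat xs ?orbT.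
transitivity ((alpha ^+ size s * (1 - alpha ^+ L) ^+ size ts)%:E -
  (alpha ^+ size (s ++ blk t) * (1 - alpha ^+ L) ^+ size ts)%:E)%E.
  by congr (_ - _)%E.
by rewrite -EFinB size_cat sL exprD exprS; congr (_%:E); ring.
Qed.

(** More than e^k disjoint blocks of length [2 * h] are tried, each being full with probability at
    least e^(- s k); as [s < 1], the expected number of full blocks grows like e^((1 - s) k) at
    least. *)
Lemma ae_long_run (s : R) : 0 < s < 1 ->
  {ae P, forall w, \forall k \near \oo,
    let h := Num.truncn (s * k%:R / (2 * - ln alpha)) in
    exists j : nat, [/\ (h <= j)%N,
      (j + h <= (Num.truncn (expR k%:R : R)).+1 * (2 * h))%N &
      forall x : int, (`|x - j%:Z| < h)%N -> site x w = p]}.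
Proof.
move=> /andP[s0 s1]; rewrite -/b.
pose B k := (Num.truncn (expR k%:R : R)).+1; pose h k := Num.truncn (s * k%:R / (2 * b)).
pose L k := (2 * h k)%N.
pose blk k (t : nat) := [seq (t * L k)%N%:Z + i%:Z | i <- iota 0 (L k)].
pose E k := [set w | forall t, t \in iota 0 (B k) -> ~ all_min (blk k t) w].
have uniq_blk k m n : uniq (flatten (map (blk k) (iota m n))).
  elim: n m => [//|n IH] m /=; rewrite cat_uniq uniq_interval IH andbT/=.
  apply/hasPn => x /flattenP[_ /mapP[t + ->]] /mapP[i]; rewrite !mem_iota => tm it ->.
  apply/negP => /mapP[j]; rewrite mem_iota => jl e.
  have : (t * L k + i = m * L k + j)%N by clear -e; lia.
  have : (m.+1 * L k <= t * L k)%N by rewrite leq_mul2r; apply/orP; right; clear -tm; lia.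
  by rewrite mulSn; clear -it jl; lia.
have sz k t : size (blk k t) = L k by rewrite size_map size_iota.
have mPE k := prob_no_full_block (L k) (blk k) (iota 0 (B k)) [::] (uniq_blk k _ _) (sz k).
have mE k : measurable (E k) by exact: (mPE k).1.
pose q := expR (- (1 - s)).
have q01 : 0 < q < 1 by rewrite expR_gt0 expR_lt1 oppr_lt0 subr_gt0.
have PE k : (P (E k) <= (1 * q ^+ k)%:E)%E.
  have := (mPE k).2; rewrite -/(E k) (_ : all_min [::] = setT); last first.
    by apply/seteqP; split.
  rewrite setTI size_iota/= expr0 !mul1r => ->; rewrite lee_fin.
  set a := alpha ^+ L k.
  have a0 : 0 < a by rewrite /a alphaX expR_gt0.
  have a1 : a <= 1 by rewrite /a alphaX expR_le1 oppr_le0 mulr_ge0// ltW.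
  have ha : expR (- (s * k%:R)) <= a.
    rewrite /a alphaX ler_expR lerN2 /L natrM mulrA -ler_pdivlMl ?mulr_gt0//.
    rewrite [b * 2]mulrC [leRHS]mulrC truncn_le divr_ge0 ?mulr_ge0//; exact: ltW.
  have hB : expR k%:R <= (B k)%:R :> R by rewrite ltW// truncnS_gt.
  have hq : (q ^+ k)^-1 <= a * (B k)%:R.
    have -> : (q ^+ k)^-1 = expR (- (s * k%:R)) * expR k%:R.
      by rewrite /q -expRM_natr -expRN -expRD; congr expR; ring.
    by apply: ler_pM => //; rewrite expR_ge0.
  (* With y = a B, at least e^((1 - s) k), the probability is at most exp(- y); the crude bound 1 /
     y is already geometric in [k]. *)
  have h1 : (1 - a) ^+ B k <= expR (- (a * (B k)%:R)).
    rewrite -mulNr expRM_natr; apply: lerXn2r; rewrite ?nnegrE ?expR_ge0 ?subr_ge0//.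
    exact: expR_ge1Dx.
  apply: le_trans h1 _; rewrite expRN -[leRHS]invrK lef_pV2 ?posrE ?expR_gt0//.
    apply: le_trans hq _; apply: le_trans (expR_ge1Dx _); lra.
  by rewrite invr_gt0 exprn_gt0//; case/andP: q01.
have := borel_cantelli_geometric _ _ _ P E 1 q mE ler01 q01 PE.
apply: filterS => w; apply: filterS => k; rewrite -/(h k).
move=> /existsNP[t /not_implyP[]]; rewrite mem_iota/= add0n => tB /contrapT/all_min_run tr.
(* The centre of the full block. *)
exists (t * L k + h k)%N; split; first exact: leq_addl.
  rewrite -/(B k) -/(L k) -addnA addnn -mul2n -/(L k) -mulSnr leq_mul2r tB orbT//.
move=> x xh; have := tr `|x - (t * L k)%N%:Z|%N; rewrite /L in xh *.
have e : (t * (2 * h k))%N%:Z + `|x - (t * (2 * h k))%N%:Z|%N%:Z = x.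
  by move: (t * _)%N xh => u; clear; lia.
by rewrite e; apply; move: (t * _)%N xh => u; clear; lia.
Qed.

End RandomEnvironment.

Section EnvironmentSupport.
Context {R : realType} (P : probability (environment R) R).
Hypothesis hident : identically_distributed P (@site R).

Lemma ae_site_notin (B : set R) (x : int) : measurable B ->
  P [set w | B (site 0 w)] = 0%E -> {ae P, forall w, ~ B (site x w)}.
Proof.
move=> mB PB; exists [set w | B (site x w)]; split.
- exact: measurable_site_preimage.
- by rewrite -PB; exact: hident.
- by move=> w /= /contrapT.
Qed.

Lemma ae_forall_int (Q : int -> environment R -> Prop) :
  (forall x, {ae P, forall w, Q x w}) -> {ae P, forall w, forall x, Q x w}.
Proof.
move=> H; have : {ae P, forall w, forall n : nat, Q n%:Z w /\ Q (- n%:Z) w}.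
  apply: ae_foralln => n; have h1 := H n%:Z; have h2 := H (- n%:Z).
  by near=> w; split; near: w.
apply: filterS => w Hw x; have [h1 h2] := Hw `|x|%N.
have : x = `|x|%N%:Z \/ x = - `|x|%N%:Z by clear; lia.
by case=> [|] e; rewrite e.
Unshelve. all: by end_near. Qed.

(** The infimum need not be attained, so the open half-line below it is exhausted by closed ones
    ending at [omega_min P - n.+1%:R^-1], each null by definition of the infimum. *)
Lemma ae_site_ge_omega_min (x : int) : {ae P, forall w, omega_min P <= site x w}.
Proof.
have lb : has_lbound [set x : R | (0 < P [set w | (site 0 w <= x)%R])%E].
  exists 0 => y /=; rewrite leNgt; apply: contraTN => y0.
  have -> : [set w : environment R | site 0 w <= y] = set0.
    apply/seteqP; split => w //=; rewrite leNgt => /negP; apply.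
    by apply: (lt_trans y0); have /andP[] := site_oo w 0.
  by rewrite measure0 ltxx.
pose F n := [set w : environment R | site 0 w <= omega_min P - n.+1%:R^-1].
have mF n : measurable (F n).
  apply: (measurable_site_preimage 0 [set y | y <= omega_min P - n.+1%:R^-1]).
  by rewrite -set_itvNyc; exact: measurable_itv.
have F0 n : P (F n) = 0%E.
  apply/eqP; rewrite eq_le measure_ge0 andbT leNgt; apply/negP => h.
  have := ge_inf lb h; rewrite -/(omega_min P) leNgt => /negP; apply.
  by rewrite ltrBlDr ltrDl invr_gt0.
have U0 : P [set w | `]-oo, omega_min P[%classic (site 0 w)] = 0%E.
  apply/negligibleP.
    by apply: measurable_site_preimage; exact: measurable_itv.
  apply: negligibleS (negligible_bigcup (F := F) _); last first.
    by move=> k; apply/negligibleP; [exact: mF|exact: F0].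
  move=> w /=; rewrite in_itv/= => h.
  have h0 : 0 < omega_min P - site 0 w by rewrite subr_gt0.
  exists (Num.truncn (omega_min P - site 0 w)^-1) => //=; rewrite /F/=.
  rewrite lerBrDr -lerBrDl -[leRHS]invrK lef_pV2 ?posrE ?invr_gt0//.
  by rewrite ltW// truncnS_gt.
have := ae_site_notin _ x (measurable_itv _) U0.
by apply: filterS => w /=; rewrite in_itv/= => /negP; rewrite -leNgt.
Qed.

Lemma ae_environment (c eta : R) :
  (forall x : int, P [set w | c <= site x w <= 1 - c] = 1%E) ->
  P [set w | omega_min P < site 0 w < omega_min P + eta] = 0%E ->
  {ae P, forall w, forall x, [/\ c <= site x w <= 1 - c, omega_min P <= site x w &
    site x w != omega_min P -> omega_min P + eta <= site x w]}.
Proof.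
move=> hc hg; apply: ae_forall_int => x.
have h1 : {ae P, forall w, c <= site x w <= 1 - c}.
  have mA : measurable ([set w | c <= site x w <= 1 - c] : set (environment R)).
    apply: (measurable_site_preimage x [set y | c <= y <= 1 - c]).
    by rewrite -set_itvcc; exact: measurable_itv.
  exists (~` [set w | c <= site x w <= 1 - c]); split=> //.
    exact: measurableC.
  by rewrite probability_setC// hc subee.
have h2 := ae_site_ge_omega_min x.
have h3 := @ae_site_notin [set y | omega_min P < y < omega_min P + eta] x _ hg.
have {}h3 : {ae P, forall w, ~ (omega_min P < site x w < omega_min P + eta)}.
  by apply: h3; rewrite -set_itvoo; exact: measurable_itv.
near=> w; split; [by near: w|by near: w|] => ne.
have a1 : omega_min P <= site x w by near: w.
have a2 : ~ (omega_min P < site x w < omega_min P + eta) by near: w.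
by rewrite leNgt; apply/negP => h; apply: a2; rewrite h andbT lt_neqAle eq_sym ne.
Unshelve. all: by end_near. Qed.

End EnvironmentSupport.

(** * Asymptotics *)

Section RealAsymptotics.
Context {R : realType}.
Implicit Types (C eps K c x : R).

(** With x = ln n, a cost [x * expR (g * x)] has to lose against [expR x / x ^+ 2]: the two powers
    of [x] together form the cube. *)
Lemma cube_le_expR C eps : 0 < eps -> \forall x \near +oo, C * x ^+ 3 <= expR (eps * x).
Proof.
move=> e0; near=> x.
have x0 : 0 < x by near: x; apply: nbhs_pinfty_gt; exact: num_real.
have xC : C * 24 / eps ^+ 4 <= x.
  by near: x; apply: nbhs_pinfty_ge; exact: num_real.
have := @expR_ge1Dxn R (eps * x) 3 (mulr_ge0 (ltW e0) (ltW x0)).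
apply: le_trans; apply: ler_wpDl => //.
have -> : (eps * x) ^+ 4 / 4`!%:R = x * eps ^+ 4 / 24 * x ^+ 3.
  by rewrite -[4`!]/24%N; field.
by rewrite ler_pM2r ?exprn_gt0// ler_pdivlMr// -ler_pdivrMr ?exprn_gt0.
Unshelve. all: by end_near. Qed.

Lemma nearp_ge (K : R) : \forall x \near +oo, K <= x.
Proof. by apply: nbhs_pinfty_ge; exact: num_real. Qed.

Lemma near_ln (Q : R -> Prop) : (\forall x \near +oo, Q x) ->
  \forall n \near \oo, Q (ln n%:R).
Proof.
move=> [M [Mr H]]; near=> n.
apply: H; rewrite -ltr_expR lnK ?posrE.
  by near: n; exact: nbhs_infty_gtr.
by rewrite ltr0n; near: n; exact: nbhs_infty_gt.
Unshelve. all: by end_near. Qed.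

Lemma powR_near_ge (K d : R) : 0 < d -> \forall x \near +oo, K <= x `^ d.
Proof.
move=> d0; near=> x.
have K0 : 0 <= Num.max K 0 by rewrite le_max lexx orbT.
have xK : Num.max K 0 `^ d^-1 <= x by near: x; exact: nearp_ge.
apply: (@le_trans _ _ (Num.max K 0)); first by rewrite le_max lexx.
rewrite -[leLHS](powRr1 K0) -(mulVf (lt0r_neq0 d0)) powRrM.
by apply: ge0_ler_powR => //; rewrite ?nnegrE ?powR_ge0 ?ltW//; apply: le_trans xK;
  rewrite powR_ge0.
Unshelve. all: by end_near. Qed.

(** Half of the gain absorbs the cost; the other half exceeds [x], hence [- ln eps]. *)
Lemma exp_tradeoff (K c g eps : R) : 0 < c -> g < 1 -> 0 < eps ->
  \forall x \near +oo,
    expR (K * (x * expR (g * x)) - c * (expR x / x ^+ 2)) <= eps.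
Proof.
move=> c0 g1 e0; near=> x.
have x0 : 1 <= x by near: x; exact: nearp_ge.
have h1 : 2 * K / c * x ^+ 3 <= expR ((1 - g) * x).
  by near: x; apply: cube_le_expR; rewrite subr_gt0.
have h2 : 2 / c * x ^+ 3 <= expR (1 * x) by near: x; apply: cube_le_expR.
have h3 : - ln eps <= x by near: x; exact: nearp_ge.
have x2 : 0 < x ^+ 2 by rewrite exprn_gt0//; lra.
rewrite -[leRHS](@lnK R eps) ?posrE// ler_expR.
have k1 : K * (x * expR (g * x)) <= c / 2 * (expR x / x ^+ 2).
  have -> : expR x = expR (g * x) * expR ((1 - g) * x).
    by rewrite -expRD; congr expR; ring.
  rewrite (_ : c / 2 * _ = c / 2 * expR ((1 - g) * x) / x ^+ 2 * expR (g * x)); last by ring.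
  rewrite mulrA ler_pM2r ?expR_gt0// ler_pdivlMr//.
  apply: le_trans (ler_wpM2l _ h1); last by rewrite divr_ge0 ?ltW.
  rewrite le_eqVlt; apply/orP; left; apply/eqP.
  by field; rewrite gt_eqF.
have k2 : x <= c / 2 * (expR x / x ^+ 2).
  rewrite mulrA ler_pdivlMr//; rewrite mul1r in h2.
  apply: le_trans (ler_wpM2l _ h2); last by rewrite divr_ge0 ?ltW.
  rewrite le_eqVlt; apply/orP; left; apply/eqP.
  by field; rewrite gt_eqF.
lra.
Unshelve. all: by end_near. Qed.

(** [beta < 2] enters through e^x / x^beta = x^(2 - beta) e^x / x^2, where the power of [x]
    eventually exceeds [(K2 + 1) / lam]; the spare unit reduces the claim to [exp_tradeoff]. The
    [- 1], due to rounding a distance to an integer, is paid by [expR lam]. *)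
Lemma exp_tradeoff_powR (lam K1 K2 g beta eps : R) : 0 < lam -> g < 1 -> beta < 2 ->
  0 < eps -> \forall x \near +oo,
    expR (- (lam * (expR x / x `^ beta - 1)) + K1 * (x * expR (g * x)) +
          K2 * (expR x / x ^+ 2)) <= eps.
Proof.
move=> l0 g1 b2 e0.
have H := @exp_tradeoff K1 1 g (eps / expR lam) ltr01 g1 (divr_gt0 e0 (expR_gt0 _)).
near=> x.
have x0 : 1 <= x by near: x; exact: nearp_ge.
have h1 : (K2 + 1) / lam <= x `^ (2 - beta).
  by near: x; apply: powR_near_ge; rewrite subr_gt0.
have h2 : expR (K1 * (x * expR (g * x)) - 1 * (expR x / x ^+ 2)) <= eps / expR lam.
  by near: x; exact: H.
rewrite ler_pdivlMr ?expR_gt0// -expRD in h2.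
apply: le_trans h2; rewrite ler_expR.
have xn0 : x != 0 by rewrite gt_eqF//; lra.
have e1 : expR x / x `^ beta = x `^ (2 - beta) * (expR x / x ^+ 2).
  rewrite powRB ?xn0 ?implybT// -[2]/(2%:R) powR_mulrn; last lra.
  by field; rewrite xn0 powR_eq0 negb_and xn0.
have y0 : 0 <= expR x / x ^+ 2 by rewrite divr_ge0 ?expR_ge0 ?exprn_ge0//; lra.
rewrite ler_pdivrMr// in h1.
have := ler_wpM2r y0 h1; rewrite e1; lra.
Unshelve. all: by end_near. Qed.

End RealAsymptotics.

Section QuenchedAsymptotics.
Context {R : realType} (om : int -> R) (p r delta b c : R).
Hypotheses (p1 : 2^-1 < p < 1) (r0 : 0 < r) (pr2 : p * r ^+ 2 = 1 - p).
Hypothesis delta01 : 0 < delta < 1.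
Hypothesis om01 : forall x, 0 < om x < 1.
Hypothesis om_defect : forall x, om x != p ->
  om x * r + (1 - om x) / r <= 2 * p * r * (1 - delta).
Hypotheses (b0 : 0 < b) (c0 : 0 < c) (om_c : forall x, c <= om x <= 1 - c).

Let rho := 2 * p * r.

Let rho0 : 0 < rho.
Proof. by rewrite /rho !mulr_gt0//; case/andP: p1; lra. Qed.

Lemma near_ge_ln (K : R) : \forall n \near \oo, K <= ln n%:R :> R.
Proof. exact: near_ln (nearp_ge K). Qed.

Lemma near_nat (Q : nat -> Prop) (f : nat -> nat) : (\forall k \near \oo, Q k) ->
  (forall K : nat, \forall n \near \oo, (K <= f n)%N) -> \forall n \near \oo, Q (f n).
Proof. by move=> [k0 _ Hk] /(_ k0); apply: filterS => n kn; exact: Hk. Qed.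

(* With k ~ g ln n, the run lies within distance e^k (2 h) = O(n^g ln n) of 0. *)
Lemma bridge_lower_asympt (s g A : R) :
  0 < s -> 0 < g < 1 -> 0 < A < s * g / b ->
  (\forall k \near \oo,
     let h := Num.truncn (s * k%:R / (2 * b)) in
     exists j : nat, [/\ (h <= j)%N,
       (j + h <= (Num.truncn (expR k%:R : R)).+1 * (2 * h))%N &
       forall x : int, (`|x - j%:Z| < h)%N -> om x = p]) ->
  exists K : R, \forall n \near \oo, let x := ln n%:R in
    expR (- (K * (x * expR (g * x)))) * (rho * cos (pi / (A * x))) ^+ (2 * n) <=
    bridge om (2 * n) 0.
Proof.
move=> s0 /andP[g0 g1] /andP[A0 As] runs.
pose kap := c ^+ 2 * r.
have kap0 : 0 < kap by rewrite mulr_gt0// exprn_gt0.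
(* [M] is at most [2 * expR (g * x)] blocks of length [2 * h <= s * g / b * x]. *)
pose K0 := 2 * (s * g / b).
exists (K0 * - ln kap).
pose k (n : nat) := Num.truncn (g * ln n%:R : R).
have kinf (K : nat) : \forall n \near \oo, (K <= k n)%N.
  near=> n; have h : K%:R / g <= ln n%:R :> R by near: n; exact: near_ge_ln.
  have Kg : K%:R <= g * ln n%:R by rewrite mulrC -ler_pdivrMr.
  by rewrite truncn_ge_nat// (le_trans _ Kg).
have {}runs := near_nat _ _ runs kinf.
have K0A : 0 < s * g / b - A by rewrite subr_gt0.
have big : \forall n \near \oo, K0 * (ln n%:R) ^+ 3 <= expR ((1 - g) * ln n%:R) :> R.
  by apply: (near_ln (fun x => K0 * x ^+ 3 <= expR ((1 - g) * x)));
    apply: cube_le_expR; rewrite subr_gt0.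
near=> n.
have n0 : (0 < n)%N by near: n; exact: nbhs_infty_gt.
have x1 : 1 <= ln n%:R :> R by near: n; exact: near_ge_ln.
have x2 : 2 / A <= ln n%:R :> R by near: n; exact: near_ge_ln.
(* [s / b + 2] is the length lost by rounding down [k] and [h]; the margin above [A] pays for it. *)
have x3 : (s / b + 2) / (s * g / b - A) <= ln n%:R :> R by near: n; exact: near_ge_ln.
have x4 : K0 * ln n%:R ^+ 3 <= expR ((1 - g) * ln n%:R) :> R by near: n.
set x : R := ln n%:R in x1 x2 x3 x4 *.
have ex : expR x = n%:R by rewrite lnK// posrE ltr0n.
have [j [hj jM runj]] : let h := Num.truncn (s * (k n)%:R / (2 * b)) in
     exists j : nat, [/\ (h <= j)%N,
       (j + h <= (Num.truncn (expR (k n)%:R : R)).+1 * (2 * h))%N &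
       forall x : int, (`|x - j%:Z| < h)%N -> om x = p] by near: n.
move: hj jM runj; set h := Num.truncn _; set M := (_ * (2 * h))%N => hj jM runj.
have gx0 : 0 <= g * x.
  by apply: mulr_ge0; [exact: ltW|exact: le_trans x1].
have kle : (k n)%:R <= g * x by rewrite truncn_le.
have kgt : g * x < (k n)%:R + 1 by rewrite natr1; exact: truncnS_gt.
clearbody x.
have b2 : 0 < 2 * b by rewrite mulr_gt0.
have skb0 : 0 <= s * (k n)%:R / (2 * b).
  by apply: divr_ge0; rewrite ?mulr_ge0// ltW.
have hle : 2 * h%:R <= s * g / b * x.
  have h1 : h%:R <= s * (k n)%:R / (2 * b) by rewrite truncn_le.
  have h2 : s * (k n)%:R / (2 * b) <= s * (g * x) / (2 * b).
    by rewrite ler_pM2r ?invr_gt0// ler_pM2l.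
  have -> : s * g / b * x = 2 * (s * (g * x) / (2 * b)) by field; rewrite gt_eqF.
  lra.
have hge : A * x <= 2 * h%:R.
  have h1 : s * (k n)%:R / (2 * b) < h%:R + 1 by rewrite natr1; exact: truncnS_gt.
  have h2 : s * (g * x - 1) / (2 * b) <= s * (k n)%:R / (2 * b).
    by rewrite ler_pM2r ?invr_gt0// ler_pM2l//; lra.
  have e : s * (g * x - 1) / (2 * b) = (s * g / b * x - s / b) / 2 by field; rewrite gt_eqF.
  rewrite e in h2.
  move: x3; rewrite ler_pdivrMr//; lra.
have Ax2 : 2 <= A * x by move: x2; rewrite ler_pdivrMr// mulrC.
have h0 : (0 < h)%N by rewrite -(ltr0n R); lra.
have MK : M%:R <= K0 * (x * expR (g * x)).
  have B2 : (Num.truncn (expR (k n)%:R : R)).+1%:R <= 2 * expR (g * x).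
    have h1 : (Num.truncn (expR (k n)%:R : R))%:R <= expR (k n)%:R :> R.
      by rewrite truncn_le expR_ge0.
    have h2 : expR (k n)%:R <= expR (g * x) by rewrite ler_expR.
    have h3 : 1 <= expR (g * x) by rewrite -expR0 ler_expR.
    rewrite -natr1; lra.
  rewrite /M natrM.
  have -> : K0 * (x * expR (g * x)) = 2 * expR (g * x) * (s * g / b * x).
    by rewrite /K0; ring.
  by apply: ler_pM => //; rewrite natrM.
have Mn : (M <= n)%N.
  rewrite -(ler_nat R) -ex; apply: le_trans MK _.
  have -> : expR x = expR (g * x) * expR ((1 - g) * x).
    by rewrite -expRD; congr expR; ring.
  rewrite mulrA [leRHS]mulrC ler_pM2r ?expR_gt0//.
  apply: le_trans x4; rewrite ler_pM2l; last first.
    by rewrite /K0 mulr_gt0// divr_gt0// mulr_gt0.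
  by rewrite -[leLHS]expr1; apply: ler_weXn2l.
have := @bridge_ge_run R om p r p1 r0 pr2 om01 c j h M n c0 om_c runj.
have -> : (0 < h <= j.+1)%N by rewrite h0/= leqW.
have jM2 : (j + M <= 2 * n)%N by clear -jM Mn; lia.
move=> /(_ erefl jM jM2); apply: le_trans; rewrite -/rho -/kap.
have cosA0 : 0 <= cos (pi / (A * x)).
  apply: cos_ge0_pihalf; have := @pi_gt0 R => pi0.
  have : pi / (A * x) <= pi / 2.
    by rewrite ler_pM2l// lef_pV2 ?posrE//; lra.
  have : 0 <= pi / (A * x) by rewrite divr_ge0 ?ltW//; lra.
  by move=> h1 h2; rewrite h2 andbT; lra.
have cosle : cos (pi / (A * x)) <= cos (pi / (2 * h%:R)).
  apply: le_cos.
  - by rewrite divr_ge0 ?pi_ge0// mulr_ge0.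
  - by rewrite ler_pM2l ?pi_gt0// lef_pV2 ?posrE//; lra.
  - rewrite ler_pdivrMr; last lra.
    by rewrite ler_peMr ?pi_ge0//; lra.
apply: ler_pM.
- exact: expR_ge0.
- by rewrite exprn_ge0// mulr_ge0// ltW.
- rewrite -[leRHS](@lnK R); last by rewrite posrE exprn_gt0.
  rewrite ler_expR lnXn// -mulr_natr lerNl -mulNr.
  rewrite [leRHS](_ : _ = - ln kap * (K0 * (x * expR (g * x)))); last by ring.
  apply: ler_wpM2l => //; rewrite oppr_ge0 ln_le0//.
  have /andP[h1 h2] := om_c 0; have r1 := tilt_lt1 p r p1 pr2.
  have cc : c <= 1 by lra.
  by rewrite /kap mulr_ile1 ?exprn_ge0 ?exprn_ile1// ltW.
- apply: lerXn2r; rewrite ?nnegrE.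
  + by rewrite mulr_ge0// ltW.
  + by rewrite mulr_ge0 ?(ltW rho0)//; apply: le_trans cosle.
  + by rewrite ler_pM2l.
Unshelve. all: by end_near. Qed.

(** Rounding [g * ln n] up makes the box e^k contain all distances up to n^g. The margin between
    [s * g / b] and [A] absorbs this rounding together with the constant excess [8 / delta]. *)
Lemma bridge_in_upper_asympt (s g A : R) : 0 < s -> 0 < g -> s * g / b < A ->
  (\forall k \near \oo, forall y : int,
    (`|y| <= Num.truncn (expR k%:R : R))%N ->
    ~ run om p y (Num.truncn (s * k%:R / b)).+1) ->
  \forall n \near \oo, let x := ln n%:R in
    bridge_in om (Num.truncn (expR (Num.truncn (g * x)).+1%:R : R)) (2 * n) 0 <=
    (rho * cos (pi / (A * x))) ^+ (2 * n).
Proof.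
move=> s0 g0 As runs; have /andP[d0 d1] := delta01.
pose k (n : nat) := (Num.truncn (g * ln n%:R : R)).+1.
have sgb0 : 0 < s * g / b by rewrite divr_gt0// mulr_gt0.
have A0 : 0 < A by exact: lt_trans As.
have kinf (K : nat) : \forall n \near \oo, (K <= k n)%N.
  near=> n; have h : K%:R / g <= ln n%:R :> R by near: n; exact: near_ge_ln.
  have Kg : K%:R <= g * ln n%:R by rewrite mulrC -ler_pdivrMr.
  by apply: leqW; rewrite truncn_ge_nat// (le_trans _ Kg).
have {}runs := near_nat _ _ runs kinf.
have K0A : 0 < A - s * g / b by rewrite subr_gt0.
near=> n.
have x1 : 1 <= ln n%:R :> R by near: n; exact: near_ge_ln.
have x2 : (s / b + 1 + 8 / delta) / (A - s * g / b) <= ln n%:R :> R by near: n; exact: near_ge_ln.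
(* Ensures [th <= delta / 4], from which both smallness conditions on the frequency follow. *)
have x3 : 4 * pi / delta / (s * g / b) <= ln n%:R :> R by near: n; exact: near_ge_ln.
set x : R := ln n%:R in x1 x2 x3 *.
have norun : forall y : int, (`|y| <= Num.truncn (expR (k n)%:R : R))%N ->
    ~ run om p y (Num.truncn (s * (k n)%:R / b)).+1 by near: n.
set l := (Num.truncn (s * (k n)%:R / b)).+1 in norun.
have gx0 : 0 <= g * x.
  by apply: mulr_ge0; [exact: ltW|exact: le_trans x1].
have kgt : g * x < (k n)%:R by exact: truncnS_gt.
have kle : (k n)%:R <= g * x + 1 by rewrite /k -natr1 lerD2r truncn_le.
rewrite [(Num.truncn (g * x)).+1](_ : _ = k n)//; clearbody x.
have D0 : 0 < 8 / delta by rewrite divr_gt0.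
have lgt : s * (k n)%:R / b < l%:R by exact: truncnS_gt.
have lle : l%:R <= s * (k n)%:R / b + 1.
  by rewrite /l -natr1 lerD2r truncn_le; apply: divr_ge0; rewrite ?mulr_ge0// ltW.
have lA : l%:R + 8 / delta <= A * x.
  have h1 : s * (k n)%:R / b <= s * (g * x + 1) / b.
    by rewrite ler_pM2r ?invr_gt0// ler_pM2l.
  have e : s * (g * x + 1) / b = s * g / b * x + s / b by field; rewrite gt_eqF.
  rewrite e in h1; move: x2; rewrite ler_pdivrMr//; lra.
have lge : 4 * pi / delta <= l%:R.
  have h1 : s * (g * x) / b <= s * (k n)%:R / b.
    by rewrite ler_pM2r ?invr_gt0// ler_pM2l// ltW.
  have e : s * (g * x) / b = x * (s * g / b) by ring.
  by rewrite e in h1; move: x3; rewrite ler_pdivrMr//; lra.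
pose th := pi / (l%:R + 8 / delta).
have ld0 : 0 < l%:R + 8 / delta by rewrite ltr_wpDl.
have th0 : 0 < th by rewrite divr_gt0 ?pi_gt0.
have thd : th <= delta / 4.
  rewrite /th ler_pdivrMr//.
  have : delta / 4 * (4 * pi / delta) <= delta / 4 * (l%:R + 8 / delta).
    by rewrite ler_pM2l ?divr_gt0//; lra.
  rewrite [delta / 4 * (4 * pi / delta)](_ : _ = pi)//.
  by field; rewrite gt_eqF.
have := @bridge_in_le_cos R om p r delta p1 r0 pr2 delta01 om01 om_defect
  (Num.truncn (expR (k n)%:R : R)) l (2 * n) th norun th0.
have -> : th * (l%:R + 8 / delta) = pi by rewrite /th divfK// gt_eqF.
have t2 : th ^+ 2 <= delta.
  by rewrite expr2; apply: le_trans (ler_pM (ltW th0) (ltW th0) thd thd) _; nra.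
have t3 : th * (8 / delta) <= 2.
  rewrite mulrA ler_pdivrMr//; lra.
move=> /(_ erefl t2 t3) hin; apply: le_trans hin _.
have pi2 := @pi_ge2 R.
have cth0 : 0 <= cos th by apply: cos_ge0_pihalf; lra.
have Ax0 : 0 < A * x by rewrite mulr_gt0//; lra.
have cosle : cos th <= cos (pi / (A * x)).
  apply: le_cos; first by rewrite divr_ge0 ?pi_ge0 ?ltW.
    by rewrite ler_pM2l ?pi_gt0// lef_pV2 ?posrE.
  lra.
apply: lerXn2r; rewrite ?nnegrE ?(mulr_ge0 (ltW rho0))//.
  exact: le_trans cosle.
by rewrite ler_pM2l.
Unshelve. all: by end_near. Qed.

End QuenchedAsymptotics.

(** * The two limits in a fixed environment *)

Section QuenchedLimits.
Context {R : realType} (w : environment R) (Q : probability trajectory R).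
Hypothesis hQ : quenched_law w Q.

Let om (x : int) : R := site x w.

Variables (rho K g A : R).
Hypotheses (rho0 : 0 < rho) (g1 : g < 1) (A0 : 0 < A).
Hypothesis lower : \forall n \near \oo, let x := ln n%:R in
  expR (- (K * (x * expR (g * x)))) * (rho * cos (pi / (A * x))) ^+ (2 * n) <=
  bridge om (2 * n) 0.

(** The powers of [rho] cancel in the quotient of the weights, and each of the [2 * n] steps gains
    [cos t1 / cos t2 <= expR (- D)]; the total gain beats the cost K n^g ln n. *)
Lemma cond_prob_max_cvg1 (gam g0 A1 : R) : 0 < A1 < A -> gam <= g0 ->
  (\forall n \near \oo, let x := ln n%:R in
    bridge_in om (Num.truncn (expR (Num.truncn (g0 * x)).+1%:R : R)) (2 * n) 0 <=
    (rho * cos (pi / (A1 * x))) ^+ (2 * n)) ->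
  cond_prob Q [set X | n%:R `^ gam <= (max_abs X (2 * n))%:R]
    [set X | X (2 * n)%N = 0] @[n --> \oo] --> (1 : R).
Proof.
move=> /andP[A10 A1A] gg upper; apply/cvgrPdist_le => eps e0.
(* [c2 / x ^+ 2] is the bound of [cos_gap] for the frequencies pi / (A1 x) and pi / (A x). *)
pose c2 := pi ^+ 2 * (A1 ^- 2 - A ^- 2) / 8 : R.
have c20 : 0 < c2.
  rewrite /c2 divr_gt0// mulr_gt0 ?exprn_gt0 ?pi_gt0//.
  rewrite subr_gt0 ltf_pV2 ?posrE ?exprn_gt0//.
  by rewrite ltrXn2r ?nnegrE// ltW.
have c2' : 0 < 2 * c2 by rewrite mulr_gt0.
have trade := near_ln _ (exp_tradeoff K (2 * c2) g eps c2' g1 e0).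
near=> n.
have n0 : (0 < n)%N by near: n; exact: nbhs_infty_gt.
have x1 : 1 <= ln n%:R :> R by near: n; exact: near_ge_ln.
have x2 : pi / A1 <= ln n%:R :> R by near: n; exact: near_ge_ln.
have lo : expR (- (K * (ln n%:R * expR (g * ln n%:R)))) *
  (rho * cos (pi / (A * ln n%:R))) ^+ (2 * n) <= bridge om (2 * n) 0 by near: n.
have up : bridge_in om (Num.truncn (expR (Num.truncn (g0 * ln n%:R)).+1%:R : R)) (2 * n) 0 <=
    (rho * cos (pi / (A1 * ln n%:R))) ^+ (2 * n) by near: n.
have tr : expR (K * (ln n%:R * expR (g * ln n%:R)) -
  2 * c2 * (expR (ln n%:R) / ln n%:R ^+ 2)) <= eps by near: n.
have ex : expR (ln n%:R) = n%:R :> R by rewrite lnK// posrE ltr0n.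
set m := Num.truncn _ in up.
have am (k : nat) : k%:R < n%:R `^ gam -> (k <= m)%N.
  move=> kn; rewrite /m truncn_ge_nat ?expR_ge0//; apply: (le_trans (ltW kn)).
  rewrite /powR -[n%:R == 0]/(_) pnatr_eq0 gtn_eqF// ler_expR.
  apply: (@le_trans _ _ (g0 * ln n%:R)); last exact/ltW/truncnS_gt.
  by rewrite ler_wpM2r// (le_trans _ x1).
set x : R := ln n%:R in x1 x2 lo up tr ex *; clearbody x.
have x0 : 0 < x by lra.
set t1 := pi / (A1 * x) in up; set t2 := pi / (A * x) in lo.
have t20 : 0 <= t2 by rewrite divr_ge0 ?pi_ge0// mulr_ge0 ?ltW.
have t12 : t2 < t1.
  by rewrite ltr_pM2l ?pi_gt0// ltf_pV2 ?posrE ?mulr_gt0// ltr_pM2r.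
have t11 : t1 <= 1.
  rewrite ler_pdivrMr ?mulr_gt0// mul1r mulrC -ler_pdivrMr//.
have pi2 := @pi_ge2 R.
have ct1 : 0 <= cos t1 by apply: cos_ge0_pihalf; apply/andP; split; lra.
have ct2 : 0 < cos t2 by apply: cos_gt0_pihalf; apply/andP; split; lra.
have [D DDef] : exists D, D = c2 / x ^+ 2 by exists (c2 / x ^+ 2).
have DE : (t1 ^+ 2 - t2 ^+ 2) / 8 = D.
  by rewrite DDef /c2 /t1 /t2; field; rewrite !gt_eqF.
have D0 : 0 <= D by rewrite DDef divr_ge0 ?exprn_ge0// ltW.
have ct12 : cos t1 <= cos t2 * expR (- D).
  have h := @cos_gap R t2 t1 t20 (ltW t12) t11; rewrite DE in h.
  apply: (@le_trans _ _ (cos t2 * (1 - D))).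
    have h3 : cos t2 * D <= 1 * D by apply: ler_wpM2r => //; exact: cos_le1.
    by rewrite mulrBr mulr1; lra.
  by rewrite ler_pM2l//; have := expR_ge1Dx (- D).
have b0 : 0 < bridge om (2 * n) 0.
  by apply: lt_le_trans lo; rewrite mulr_gt0 ?expR_gt0 ?exprn_gt0 ?mulr_gt0.
have le1 := cond_prob_max_le1 w Q hQ (n%:R `^ gam) (2 * n).
have ge1 := cond_prob_max_ge w Q hQ (n%:R `^ gam) m (2 * n) b0 am.
rewrite ger0_norm; last by rewrite subr_ge0.
apply: le_trans tr.
apply: (@le_trans _ _ (bridge_in om m (2 * n) 0 / bridge om (2 * n) 0)).
  by move: ge1; rewrite -/om; lra.
rewrite ler_pdivrMr//; apply: le_trans up _.
apply: le_trans (ler_wpM2l (expR_ge0 _) lo); rewrite [leRHS]mulrA -expRD.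
have -> : K * (x * expR (g * x)) - 2 * c2 * (expR x / x ^+ 2) + - (K * (x * expR (g * x))) =
    - D * (2 * n)%:R by rewrite ex natrM DDef; ring.
rewrite expRM_natr -exprMn; apply: lerXn2r; rewrite ?nnegrE.
- by rewrite mulr_ge0// ltW.
- by rewrite !mulr_ge0 ?expR_ge0// ltW.
- by rewrite mulrCA ler_pM2l// mulrC.
Unshelve. all: by end_near. Qed.

Lemma cond_prob_max_cvg0 (beta tau : R) : beta < 2 -> 0 < tau < 1 ->
  (\forall m \near \oo, forall N : nat,
    bridge_hit om m%:Z N 0 + bridge_hit om (- m%:Z) N 0 <= 2 * (rho ^+ N * tau ^+ m)) ->
  cond_prob Q [set X | n%:R / (ln n%:R) `^ beta <= (max_abs X (2 * n))%:R]
    [set X | X (2 * n)%N = 0] @[n --> \oo] --> (0 : R).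
Proof.
move=> b2 /andP[t0 t1] [m0 _ hit]; apply/cvgrPdist_le => eps e0.
pose lam := - ln tau.
have lam0 : 0 < lam by rewrite oppr_gt0 ln_lt0// t0.
(* From [cos t2 >= expR (- t2 ^+ 2)] with t2 = pi / (A x), raised to the power [2 * n]. *)
pose K2 := 2 * pi ^+ 2 / A ^+ 2 : R.
have e2 : 0 < eps / 2 by rewrite divr_gt0.
have trade := near_ln _ (exp_tradeoff_powR lam K K2 g beta (eps / 2) lam0 g1 b2 e2).
(* With both cost constants 0, the tradeoff just says that n / (ln n)^beta eventually exceeds
   [m0]. *)
have big := near_ln _ (exp_tradeoff_powR 1 0 0 g beta (expR (- m0%:R)) ltr01 g1 b2 (expR_gt0 _)).
near=> n.
have n0 : (0 < n)%N by near: n; exact: nbhs_infty_gt.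
have x1 : 1 <= ln n%:R :> R by near: n; exact: near_ge_ln.
have x2 : pi / A <= ln n%:R :> R by near: n; exact: near_ge_ln.
have lo : expR (- (K * (ln n%:R * expR (g * ln n%:R)))) *
  (rho * cos (pi / (A * ln n%:R))) ^+ (2 * n) <= bridge om (2 * n) 0 by near: n.
have tr : expR (- (lam * (expR (ln n%:R) / ln n%:R `^ beta - 1)) +
  K * (ln n%:R * expR (g * ln n%:R)) + K2 * (expR (ln n%:R) / ln n%:R ^+ 2)) <= eps / 2.
  by near: n.
have bg : expR (- (1 * (expR (ln n%:R) / ln n%:R `^ beta - 1)) +
  0 * (ln n%:R * expR (g * ln n%:R)) + 0 * (expR (ln n%:R) / ln n%:R ^+ 2)) <= expR (- m0%:R) :> R.
  by near: n.
have ex : expR (ln n%:R) = n%:R :> R by rewrite lnK// posrE ltr0n.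
rewrite sub0r normrN ger0_norm ?cond_prob_ge0//.
set x : R := ln n%:R in x1 x2 lo tr bg ex *; clearbody x.
have x0 : 0 < x by lra.
rewrite -ex; set a := expR x / x `^ beta in tr bg *.
have a0 : 0 <= a by rewrite divr_ge0 ?expR_ge0 ?powR_ge0.
have am : m0%:R <= a by move: bg; rewrite ler_expR; lra.
pose m := Num.truncn a.
have mm0 : (m0 <= m)%N by rewrite truncn_ge_nat.
have ma : a - 1 <= m%:R by rewrite lerBlDr natr1; exact/ltW/truncnS_gt.
have amk (k : nat) : a <= k%:R -> (m <= k)%N.
  by move=> ak; rewrite -(ler_nat R); apply: le_trans ak; rewrite truncn_le.
apply: le_trans (cond_prob_max_le w Q hQ a m (2 * n) amk) _; rewrite -/om.
set t2 := pi / (A * x) in lo.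
have t20 : 0 <= t2 by rewrite divr_ge0 ?pi_ge0// mulr_ge0 ?ltW.
have t21 : t2 <= 1.
  by rewrite ler_pdivrMr ?mulr_gt0// mul1r mulrC -ler_pdivrMr.
(* For y = t2^2 in [0, 1]: exp(- y) <= 1 / (1 + y) <= 1 - y / 2 <= cos t2. *)
have ct2 : expR (- t2 ^+ 2) <= cos t2.
  apply: le_trans (@cos_ge R t2 t20).
  have y0 : 0 <= t2 ^+ 2 by rewrite sqr_ge0.
  have y1 : t2 ^+ 2 <= 1 by rewrite expr_le1.
  rewrite expRN invf_ple ?posrE ?expR_gt0//; last lra.
  apply: le_trans (expR_ge1Dx _).
  rewrite -[leLHS]div1r ler_pdivrMr; last lra.
  move: (t2 ^+ 2) y0 y1 => y y0 y1; nra.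
have b0 : 0 < bridge om (2 * n) 0.
  apply: lt_le_trans lo; rewrite mulr_gt0 ?expR_gt0 ?exprn_gt0 ?mulr_gt0//.
  by apply: lt_le_trans ct2; rewrite expR_gt0.
rewrite ler_pdivrMr//; apply: le_trans (hit m mm0 (2 * n)%N) _.
rewrite (_ : eps = 2 * (eps / 2)); last lra.
rewrite -mulrA ler_pM2l//.
apply: le_trans (ler_wpM2r (ltW b0) tr).
apply: le_trans (ler_wpM2l (expR_ge0 _) lo).
rewrite [leRHS]mulrA -expRD exprMn.
rewrite [leRHS]mulrCA ler_pM2l ?exprn_gt0//.
apply: (@le_trans _ _ (expR (- (lam * (a - 1))))).
  have -> : tau ^+ m = expR (- lam * m%:R) by rewrite /lam opprK expRM_natr lnK.
  by rewrite ler_expR mulNr lerN2 ler_pM2l.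
have e : - (lam * (a - 1)) = - (lam * (a - 1)) + K * (x * expR (g * x)) +
    K2 * (expR x / x ^+ 2) + - (K * (x * expR (g * x))) + (- t2 ^+ 2) * (2 * n)%:R.
  by rewrite natrM -ex /t2 /K2; field; rewrite !gt_eqF.
rewrite {1}e [leLHS]expRD ler_pM2l ?expR_gt0// expRM_natr.
by apply: lerXn2r; rewrite ?nnegrE ?expR_ge0//; apply: le_trans ct2; rewrite expR_ge0.
Unshelve. all: by end_near. Qed.

End QuenchedLimits.

(** * Choice of the constants and conclusion *)

(** [s * g] measures the longest runs met within n^g, with slack [s]; [v * v] measures a run surely
    found at scale n^v, with slack [v]. With g = 1 - 4 u one has (1 + u)(1 - 4 u) < 1 - 3 u < 1 - 2
    u < (1 - u)^2. *)
Lemma run_length_constants {R : realType} (g b : R) : 0 < g < 1 -> 0 < b ->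
  exists s v A1 A, [/\ 1 < s, 0 < v < 1, s * g / b < A1, 0 < A1 < A & A < v * v / b].
Proof.
move=> /andP[g0 g1] b0; pose u := (1 - g) / 4.
have u0 : 0 < u by rewrite divr_gt0// subr_gt0.
have uE : g = 1 - 4 * u by rewrite /u; lra.
clearbody u; have uu : 0 < u * u by rewrite mulr_gt0.
exists (1 + u), (1 - u), ((1 - 3 * u) / b), ((1 - 2 * u) / b); split.
- lra.
- by apply/andP; split; lra.
- by rewrite ltr_pM2r ?invr_gt0// uE mulrDl; lra.
- by rewrite divr_gt0 ?ltr_pM2r ?invr_gt0//; lra.
- by rewrite ltr_pM2r ?invr_gt0// mulrBr mulrBl; lra.
Qed.

Theorem theorem4p1 (R : realType) (P : probability (environment R) R)
    (Pq : environment R -> probability trajectory R)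
    (hPq : forall w, quenched_law w (Pq w))
    (hindep : mutually_independent P (@site R))
    (hident : identically_distributed P (@site R))
    (hellip : exists c : R, 0 < c /\
       forall x : int, P [set w | c <= site x w <= 1 - c] = 1%E)
    (hmin : 2^-1 < omega_min P)
    (halpha : (0 < P [set w | site 0 w = omega_min P] < 1)%E)
    (hgap : exists eta : R, 0 < eta /\
       P [set w | omega_min P < site 0 w < omega_min P + eta] = 0%E) :
  (forall beta : R, beta < 2 ->
     {ae P, forall w,
        cond_prob (Pq w)
          [set X | n%:R / (ln n%:R) `^ beta <= (max_abs X (2 * n))%:R]
          [set X | X (2 * n)%N = 0] @[n --> \oo] --> (0 : R)}) /\
  (forall gamma : R, gamma < 1 ->
     {ae P, forall w,
        cond_prob (Pq w)
          [set X | n%:R `^ gamma <= (max_abs X (2 * n))%:R]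
          [set X | X (2 * n)%N = 0] @[n --> \oo] --> (1 : R)}).
Proof.
have half0 : 0 < (2^-1 : R) by rewrite invr_gt0.
have half1 : (2^-1 : R) < 1 by rewrite invf_lt1// ltr1n.
have [c [c0 hc]] := hellip; have [eta [eta0 hg]] := hgap.
have env := ae_environment P hident c eta hc hg.
move: hmin halpha env {hc hg hellip hgap}; set p := omega_min P => p_half halpha env.
have mp x : measurable ([set w | site x w = p] : set (environment R)).
  by apply: (measurable_site_preimage x [set p]); exact: measurable_set1.
pose alpha := fine (P [set w | site 0 w = p]).
have alphaE x : P [set w | site x w = p] = alpha%:E.
  rewrite /alpha fineK ?fin_num_measure//.
  exact: (hident x 0 [set p] (measurable_set1 p)).
have alpha01 : 0 < alpha < 1 by move: halpha; rewrite alphaE !lte_fin.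
have p_lt1 : p < 1.
  rewrite ltNge; apply/negP => p_ge1; move: halpha; suff -> : [set w | site 0 w = p] = set0.
    by rewrite measure0 ltxx.
  apply/seteqP; split => w //= wp.
  by have := site_oo w 0; rewrite wp => /andP[_]; rewrite ltNge p_ge1.
have p1 : 2^-1 < p < 1 by rewrite p_half.
have p0 : 0 < p by exact: lt_trans p_half.
have q0 : 0 < (1 - p) / p by rewrite divr_gt0// subr_gt0.
pose r := Num.sqrt ((1 - p) / p).
have r0 : 0 < r by rewrite sqrtr_gt0.
have pr2 : p * r ^+ 2 = 1 - p by rewrite sqr_sqrtr ?(ltW q0)// mulrC divfK// gt_eqF.
have r1 := tilt_lt1 p r p1 pr2.
pose rho := 2 * p * r.
have rho0 : 0 < rho by rewrite /rho !mulr_gt0.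
pose kappa := r^-1 - r.
have kappa0 : 0 < kappa by rewrite subr_gt0 (lt_trans r1)// invf_gt1.
(* A defect exceeds [p] by at least [eta] and so loses at least [kappa * eta] out of [rho]; the
   minimum keeps [delta] below 1. *)
pose delta := Num.min 2^-1 (kappa * eta / rho).
have delta01 : 0 < delta < 1.
  by rewrite lt_min gt_min half0 half1 divr_gt0 ?mulr_gt0.
pose b := - ln alpha.
have b0 : 0 < b by rewrite oppr_gt0 ln_lt0.
have tilt x : (1 - x) / r + x * r = rho - kappa * (x - p).
  have -> : 1 - x = p * r ^+ 2 + p - x by rewrite pr2; ring.
  by rewrite /rho /kappa; field; rewrite gt_eqF.
have defect w : (forall x, [/\ c <= site x w <= 1 - c, p <= site x w &
    site x w != p -> p + eta <= site x w]) ->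
    forall x, site x w != p ->
      site x w * r + (1 - site x w) / r <= 2 * p * r * (1 - delta).
  move=> H x ne; have [_ _ /(_ ne) xe] := H x.
  rewrite addrC tilt -/rho [rho * _]mulrBr mulr1 lerD2l lerN2.
  apply: (@le_trans _ _ (kappa * eta)); last by rewrite ler_pM2l// lerBrDl.
  by rewrite mulrC -ler_pdivlMr// ge_min lexx orbT.
split=> [beta beta2|gamma gamma1].
  (* One embedding per half-line; the absolute value in [ae_damping] is invisible because [defects]
     evaluates at naturals only. *)
  pose e1 (n : nat) := n%:Z; pose e2 (n : nat) := - n%:Z.
  have ie1 : injective e1 by move=> i j [].
  have ie2 : injective e2 by move=> i j /oppr_inj[].
  have [t1 /andP[t10 t11] D1] := ae_damping P p alpha hindep alphaE alpha01 e1 delta ie1 delta01.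
  have [t2 /andP[t20 t21] D2] := ae_damping P p alpha hindep alphaE alpha01 e2 delta ie2 delta01.
  have h01 : 0 < (2^-1 : R) < 1 by rewrite half0.
  have L := ae_long_run P p alpha hindep alphaE alpha01 2^-1 h01.
  (* Any fixed exponent below 1 and any fixed [A] work for this limit; 1/8 lies below 1/2 * 1/2. *)
  pose A := 8^-1 / b : R.
  have A0 : 0 < A by rewrite divr_gt0.
  have A1 : 0 < A < 2^-1 * 2^-1 / b by rewrite A0/= ltr_pM2r ?invr_gt0// -invfM -natrM ltf_pV2 ?posrE ?ltr_nat.
  near=> w.
  have Ew : forall x, [/\ c <= site x w <= 1 - c, p <= site x w &
    site x w != p -> p + eta <= site x w] by near: w.
  have omc x : c <= site x w <= 1 - c by have [] := Ew x.
  have [K lower] : exists K : R, \forall n \near \oo, let x := ln n%:R in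
      expR (- (K * (x * expR (2^-1 * x)))) * (rho * cos (pi / (A * x))) ^+ (2 * n) <=
      bridge (fun x => site x w) (2 * n) 0.
    apply: (bridge_lower_asympt (fun x => site x w) p r b c p1 r0 pr2 (site_oo w)
      b0 c0 omc 2^-1 2^-1 A) => //.
    by near: w.
  have D1w : \forall k \near \oo,
    (1 - delta) ^+ defects (fun x => site (e1 `|x|%N) w) p k <= t1 ^+ k by near: w.
  have D2w : \forall k \near \oo,
    (1 - delta) ^+ defects (fun x => site (e2 `|x|%N) w) p k <= t2 ^+ k by near: w.
  pose tau := Num.max t1 t2.
  have tau01 : 0 < tau < 1 by rewrite /tau lt_max gt_max t10 t11 t21.
  apply: (cond_prob_max_cvg0 w (Pq w) (hPq w) rho K 2^-1 A rho0 half1 A0 lower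
    beta tau beta2 tau01).
  near=> m => N.
  have d1 : (1 - delta) ^+ defects (fun x => site (e1 `|x|%N) w) p m <= t1 ^+ m by near: m.
  have d2 : (1 - delta) ^+ defects (fun x => site (e2 `|x|%N) w) p m <= t2 ^+ m by near: m.
  have tX t : 0 < t -> t <= tau -> t ^+ m <= tau ^+ m.
    by move=> t0 tt; apply: lerXn2r; rewrite ?nnegrE//; [exact: ltW|exact: (le_trans (ltW t0) tt)].
  rewrite mulr_natl mulr2n; apply: lerD.
    apply: le_trans (bridge_hit_right (fun x => site x w) p r delta p1 r0 pr2
      delta01 (site_oo w) (defect w Ew) m N) _.
    apply: ler_wpM2l; first by rewrite exprn_ge0// ltW.
    by apply: le_trans d1 _; apply: tX => //; rewrite le_max lexx.
  apply: le_trans (bridge_hit_left (fun x => site x w) p r delta p1 r0 pr2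
    delta01 (site_oo w) (defect w Ew) m N) _.
  apply: ler_wpM2l; first by rewrite exprn_ge0// ltW.
  by apply: le_trans d2 _; apply: tX => //; rewrite le_max lexx orbT.
(* [gamma] may be nonpositive; enlarging it only makes the required distance larger, so the bound at
   [g0] covers it. *)
pose g0 := Num.max gamma 2^-1.
have g01 : 0 < g0 < 1 by rewrite lt_max gt_max gamma1 half0 half1 orbT.
have [s [v [A1 [A [s1 v01 sA1 A1A Av]]]]] := run_length_constants g0 b g01 b0.
have S := ae_short_runs P p alpha hindep alphaE alpha01 s s1.
have L := ae_long_run P p alpha hindep alphaE alpha01 v v01.
have A0 : 0 < A by case/andP: A1A; exact: lt_trans.
have A2 : 0 < A < v * v / b by rewrite A0.
have [v0 v1] := andP v01.
near=> w.
have Ew : forall x, [/\ c <= site x w <= 1 - c, p <= site x w &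
  site x w != p -> p + eta <= site x w] by near: w.
have omc x : c <= site x w <= 1 - c by have [] := Ew x.
have [K lower] : exists K : R, \forall n \near \oo, let x := ln n%:R in
    expR (- (K * (x * expR (v * x)))) * (rho * cos (pi / (A * x))) ^+ (2 * n) <=
    bridge (fun x => site x w) (2 * n) 0.
  apply: (bridge_lower_asympt (fun x => site x w) p r b c p1 r0 pr2 (site_oo w)
    b0 c0 omc v v A) => //.
  by near: w.
have gg0 : gamma <= g0 by rewrite le_max lexx.
apply: (cond_prob_max_cvg1 w (Pq w) (hPq w) rho K v A rho0 v1 A0 lower
  gamma g0 A1 A1A gg0).
apply: (bridge_in_upper_asympt (fun x => site x w) p r delta b p1 r0 pr2 delta01
  (site_oo w) (defect w Ew) b0 s g0 A1) => //.
- exact: lt_trans s1.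
- by case/andP: g01.
- by near: w.
Unshelve. all: by end_near. Qed.
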